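(* Let $\mathcal{G}$ be a class of graphs that is contained in the class of $P_4$-extendible graphs or contained in the class of $P_4$-sparse graphs, and that is closed under taking complements and under taking induced subgraphs. Let $G$ be a graph in $\mathcal{G}$. Then $G$ is a minimal monopolar obstruction if and only if $\overline{G}$ is isomorphic to one of the seven graphs $K_1+2K_2$, $2P_3$, $2K_1+C_4$, $K_1+\overline{P_3+K_2}$, $K_1+C_5$, $K_1+P$, $K_1+\overline{P_5}$.
   Context: All graphs are simple and finite; graph classes are closed under isomorphism. $G+H$ is disjoint union and $nG$ is the disjoint union of $n$ copies of $G$. $P$ (the banner) is the 5-vertex graph obtained from $C_4$ by attaching one pendant vertex to one vertex of the cycle. A cluster is a disjoint union of complete graphs. A graph $G$ is monopolar (i.e. $(1,\infty)$-polar) if its vertex set has a partition $(A,B)$ (parts may be empty) such that $A$ is an independent set and $G[B]$ is a cluster. A minimal monopolar obstruction is a graph that is not monopolar but all of whose proper induced subgraphs are monopolar. ''A $P_4$'' of a graph means an induced path on four vertices. A graph is $P_4$-sparse if every set of five vertices induces at most one $P_4$. A graph is $P_4$-extendible if for every vertex subset $W$ inducing a $P_4$, there is at most one vertex $v\notin W$ that belongs to a $P_4$ sharing vertices with $W$. *)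

(* Defs.v *)
From mathcomp Require Import all_boot.

Set Implicit Arguments.
Unset Strict Implicit.
Unset Printing Implicit Defensive.

Record sgraph : Type := SGraph {
  vertex :> finType;
  adj : rel vertex;
  adj_sym : symmetric adj;
  adj_irr : irreflexive adj }.

Definition iso (G H : sgraph) : Prop :=
  exists2 f : G -> H, bijective f & {mono f : x y / adj x y}.

Lemma induced_sym (G : sgraph) (S : {set G}) :
  symmetric (fun x y : {x : G | x \in S} => adj (val x) (val y)).
Proof. by move=> x y; exact: adj_sym. Qed.

Lemma induced_irr (G : sgraph) (S : {set G}) :
  irreflexive (fun x y : {x : G | x \in S} => adj (val x) (val y)).
Proof. by move=> x; exact: adj_irr. Qed.

Definition induced (G : sgraph) (S : {set G}) : sgraph :=
  SGraph (@induced_sym G S) (@induced_irr G S).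

Lemma compl_sym (G : sgraph) :
  symmetric (fun x y : G => (x != y) && ~~ adj x y).
Proof. by move=> x y; rewrite eq_sym adj_sym. Qed.

Lemma compl_irr (G : sgraph) :
  irreflexive (fun x y : G => (x != y) && ~~ adj x y).
Proof. by move=> x; rewrite eqxx. Qed.

Definition compl (G : sgraph) : sgraph :=
  SGraph (@compl_sym G) (@compl_irr G).

Definition union_adj (G H : sgraph) : rel (G + H) := fun u v =>
  match u, v with
  | inl x, inl y => adj x y
  | inr x, inr y => adj x y
  | _, _ => false
  end.

Lemma union_sym (G H : sgraph) : symmetric (@union_adj G H).
Proof. by move=> [x|x] [y|y] //=; exact: adj_sym. Qed.

Lemma union_irr (G H : sgraph) : irreflexive (@union_adj G H).
Proof. by move=> [x|x] /=; exact: adj_irr. Qed.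

Definition union (G H : sgraph) : sgraph :=
  SGraph (@union_sym G H) (@union_irr G H).

Definition bigunion_adj (I : finType) (F : I -> sgraph) : rel {i : I & F i} :=
  fun u v => (tag u == tag v) && adj (tagged u) (tagged_as u v).

Lemma bigunion_sym (I : finType) (F : I -> sgraph) :
  symmetric (@bigunion_adj I F).
Proof.
move=> [i x] [j y]; rewrite /bigunion_adj /=; have [eq_ij|//] := eqVneq i j.
by case: j / eq_ij y => y; rewrite !tagged_asE adj_sym.
Qed.

Lemma bigunion_irr (I : finType) (F : I -> sgraph) :
  irreflexive (@bigunion_adj I F).
Proof. by move=> [i x]; rewrite /bigunion_adj tagged_asE adj_irr andbF. Qed.

Definition bigunion (I : finType) (F : I -> sgraph) : sgraph :=
  SGraph (@bigunion_sym I F) (@bigunion_irr I F).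

Definition copies (n : nat) (G : sgraph) : sgraph :=
  bigunion (fun _ : 'I_n => G).

Lemma complete_sym (n : nat) : symmetric (fun i j : 'I_n => i != j).
Proof. by move=> i j; rewrite eq_sym. Qed.

Lemma complete_irr (n : nat) : irreflexive (fun i j : 'I_n => i != j).
Proof. by move=> i; rewrite eqxx. Qed.

Definition complete (n : nat) : sgraph :=
  SGraph (@complete_sym n) (@complete_irr n).

Lemma path_sym (n : nat) :
  symmetric (fun i j : 'I_n => (i.+1 == j) || (j.+1 == i)).
Proof. by move=> i j; rewrite orbC. Qed.

Lemma path_irr (n : nat) :
  irreflexive (fun i j : 'I_n => (i.+1 == j) || (j.+1 == i)).
Proof. by move=> i; rewrite orbb gtn_eqF. Qed.

Definition path_graph (n : nat) : sgraph :=
  SGraph (@path_sym n) (@path_irr n).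

(* The conjunct i != j only matters for the degenerate case n = 1. *)
Definition cycle_adj (n : nat) : rel 'I_n := fun i j =>
  (i != j) && ((i.+1 == j %[mod n]) || (j.+1 == i %[mod n])).

Lemma cycle_sym (n : nat) : symmetric (@cycle_adj n).
Proof. by move=> i j; rewrite /cycle_adj eq_sym orbC. Qed.

Lemma cycle_irr (n : nat) : irreflexive (@cycle_adj n).
Proof. by move=> i; rewrite /cycle_adj eqxx. Qed.

Definition cycle_graph (n : nat) : sgraph :=
  SGraph (@cycle_sym n) (@cycle_irr n).

(* [None] is the new vertex, of degree one, adjacent to [Some x] only. *)
Definition pendant_adj (G : sgraph) (x : G) : rel (option G) := fun u v =>
  match u, v with
  | Some y, Some z => adj y z
  | Some y, None | None, Some y => y == x
  | None, None => false
  end.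

Lemma pendant_sym (G : sgraph) (x : G) : symmetric (pendant_adj x).
Proof. by move=> [y|] [z|] //=; exact: adj_sym. Qed.

Lemma pendant_irr (G : sgraph) (x : G) : irreflexive (pendant_adj x).
Proof. by move=> [y|] //=; exact: adj_irr. Qed.

Definition pendant (G : sgraph) (x : G) : sgraph :=
  SGraph (pendant_sym x) (pendant_irr x).

Definition banner : sgraph := @pendant (cycle_graph 4) (ord0 : 'I_4).

Definition independent (G : sgraph) (A : {set G}) : Prop :=
  {in A &, forall x y, ~~ adj x y}.

Definition cluster (G : sgraph) : Prop :=
  exists (k : nat) (n : 'I_k -> nat), iso G (bigunion (fun i => complete (n i))).

Definition monopolar (G : sgraph) : Prop :=
  exists A B : {set G},
    [/\ A :|: B = setT, A :&: B = set0, independent A & cluster (induced B)].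

Definition minimal_monopolar_obstruction (G : sgraph) : Prop :=
  ~ monopolar G /\
  forall S : {set G}, S \proper [set: G] -> monopolar (induced S).

Definition induces_P4 (G : sgraph) (W : {set G}) : Prop :=
  iso (induced W) (path_graph 4).

(* Induced paths are counted by their vertex sets. *)
Definition P4_sparse (G : sgraph) : Prop :=
  forall S : {set G}, #|S| = 5 ->
  forall W1 W2 : {set G}, W1 \subset S -> W2 \subset S ->
  induces_P4 W1 -> induces_P4 W2 -> W1 = W2.

Definition P4_partner (G : sgraph) (W : {set G}) (v : G) : Prop :=
  v \notin W /\
  exists W' : {set G}, [/\ induces_P4 W', W' :&: W != set0 & v \in W'].

Definition P4_extendible (G : sgraph) : Prop :=
  forall W : {set G}, induces_P4 W ->
  forall v1 v2 : G, P4_partner W v1 -> P4_partner W v2 -> v1 = v2.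

Definition graph_class (C : sgraph -> Prop) : Prop :=
  forall G H : sgraph, iso G H -> C G -> C H.

Definition compl_closed (C : sgraph -> Prop) : Prop :=
  forall G : sgraph, C G -> C (compl G).

Definition induced_closed (C : sgraph -> Prop) : Prop :=
  forall (G : sgraph) (S : {set G}), C G -> C (induced S).

(* Main.v *)
(* Work in H, the complement of G: G is monopolar iff H is covered by a clique
   and a complete multipartite set (call H polar), and a join of two polar graphs
   is polar, so a minimal non-polar H is not a join.

   If H is disconnected, no hypothesis on P4s is needed.  By Foldes and Hammer,
   H is split or contains C5, C4 or 2K2.  A C5 gives K1+C5.  Around a C4, a vertex
   of the same component sees two opposite vertices of the C4 or all of it, for
   otherwise one of the other K1+(...) obstructions appears; hence the component is
   complete multipartite and the rest is a clique.  For 2K2, one falls on K1+2K2 or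
   2P3, or on a complete multipartite part and a clique.

   If H is connected and not a join, it contains a P4 abcd by Seinsche's theorem.
   In both classes a vertex outside (the closure of) abcd sees none (N), all (A) or
   exactly b and c (R) of it.  By minimality the disconnected proper subgraphs
   induced on N + abcd and on R + a + d are polar, which forces N independent and R
   split; A is a clique since H is not a join.  This makes H split, up to a few
   small exceptions in the P4-extendible case, so H is polar: a contradiction. *)

Require Import Defs.
From mathcomp Require Import all_boot.

Set Implicit Arguments.
Unset Strict Implicit.
Unset Printing Implicit Defensive.

(** Minimality is used in two forms. A nonpolar graph embedded in H must be all of H, so H may be
    taken free of the seven graphs, each coded as an adjacency table; this drives the disconnected
    case. The connected case uses only that proper subgraphs are polar, and its lever is that a
    polar cover of a graph with a P_4 on one side of an edgeless cut is already a split cover. The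
    obstacle is then that a split partition of R knows nothing of N and A. In a P_4-sparse graph, an
    edge from N to R, or a non-edge from A to R, dictates the side of the vertex of R that it
    touches, and the two demands never collide. In a P_4-extendible graph the closure of abcd has at
    most one further vertex u, and N is anticomplete and A complete to R; the price is the position
    of u when N and A are empty. There u can be a false twin of a midpoint, creating a C_4, or a
    true twin of an endpoint, creating a 2K_2: R is then shown independent and the cover is not
    split. *)

(** * Polarity, and its transfer through complements and isomorphisms *)

Definition clique (H : sgraph) (K : {set H}) : Prop :=
  {in K &, forall x y, x != y -> adj x y}.

(** Contrapositive form of the transitivity of non-adjacency: every vertex sees an end of every
    edge. *)
Definition multipartite (H : sgraph) (M : {set H}) : Prop :=
  {in M & &, forall x y z, adj x y -> adj x z || adj y z}.

(** A cover replaces the partition: both properties are hereditary, so overlaps and vertices outside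
    [S] are harmless. *)
Definition polar (H : sgraph) (S : {set H}) : Prop :=
  exists K M : {set H}, [/\ S \subset K :|: M, clique K & multipartite M].

Definition minimal_nonpolar (H : sgraph) : Prop :=
  ~ polar [set: H] /\ forall S : {set H}, S \proper [set: H] -> polar S.

Lemma iso_sym (G H : sgraph) : iso G H -> iso H G.
Proof.
case=> f [g fK gK] mf; exists g; first by exists f.
by move=> x y; rewrite -mf !gK.
Qed.

Lemma iso_trans (G H L : sgraph) : iso G H -> iso H L -> iso G L.
Proof.
case=> f bf mf [g bg mg]; exists (g \o f); first exact: bij_comp.
by move=> x y; rewrite /= mg mf.
Qed.

Lemma adj_neq (G : sgraph) (x y : G) : adj x y -> x != y.
Proof. by apply: contraTneq => ->; rewrite adj_irr. Qed.

Lemma bigunion_completeE (k : nat) (n : 'I_k -> nat)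
    (u v : bigunion (fun i => complete (n i))) :
  adj u v = (tag u == tag v) && (u != v).
Proof.
rewrite [LHS]/(bigunion_adj u v) /bigunion_adj /= -tag_eqE /tag_eq.
by case: eqP.
Qed.

Lemma cluster_trans (G : sgraph) (x y z : G) :
  cluster G -> adj x y -> adj y z -> x != z -> adj x z.
Proof.
case=> k [n [f bf mf]]; rewrite -!mf !bigunion_completeE.
move=> /andP[/eqP-> _] /andP[/eqP-> _] xz.
by rewrite eqxx (inj_eq (bij_inj bf)).
Qed.

Lemma trans_cluster (G : sgraph) :
  (forall x y z : G, adj x y -> adj y z -> x != z -> adj x z) -> cluster G.
Proof.
move=> tr; pose sm := [rel x y : G | (x == y) || adj x y].
have sm_refl x : sm x x by rewrite /= eqxx.
have sm_sym x y : sm x y = sm y x by rewrite /= eq_sym adj_sym.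
have sm_tr x y z : sm x y -> sm y z -> sm x z.
  rewrite /=; case: eqVneq => [->//|_ /= xy]; case: eqVneq => [<-|_ /= yz].
    by rewrite xy orbT.
  by case: eqVneq => //= xz; apply: tr xy yz xz.
have sm_eq x y : sm x y -> sm x =1 sm y.
  by move=> xy z; apply/idP/idP; apply: sm_tr => //; rewrite sm_sym.
pose rt x := odflt x [pick y | sm x y].
have rtP x : sm x (rt x).
  by rewrite /rt; case: pickP => [y //|/(_ x)]; rewrite sm_refl.
have rt_eq x y : (rt x == rt y) = sm x y.
  apply/eqP/idP => [e|xy]; last first.
    rewrite /rt (eq_pick (sm_eq _ _ xy)).
    by case: pickP => // /(_ y); rewrite sm_refl.
  by apply: sm_tr (rtP x) _; rewrite e sm_sym.
(* One block per vertex of the graph, indexed by possible representatives; the block of a vertex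
   that represents nothing is empty, an instance of [complete 0]. *)
pose cl (i : 'I_#|G|) := [set x | rt x == enum_val i].
have clP x : x \in cl (enum_rank (rt x)) by rewrite inE enum_rankK.
exists #|G|, (fun i => #|cl i|).
pose T := bigunion (fun i : 'I_#|G| => complete #|cl i|).
pose f x : T := Tagged (fun i => complete #|cl i|) (enum_rank_in (clP x) x).
pose g (u : T) : G := enum_val (tagged u : 'I_#|cl (tag u)|).
have fK : cancel f g by move=> x; rewrite /g /f /= enum_rankK_in.
have gP u : rt (g u) = enum_val (tag u).
  by have := enum_valP (tagged u : 'I_#|cl (tag u)|); rewrite inE => /eqP.
have g_inj : injective g.
  move=> u v e; have tg : tag u = tag v.
    by apply: enum_val_inj; rewrite -!gP e.
  case: u v tg e => [i j] [i' j'] /= tg; case: _ / tg j' => j' e.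
  by congr Tagged; apply: enum_val_inj.
exists f; first by exists g => // u; apply: g_inj; rewrite fK.
move=> x y; rewrite bigunion_completeE (inj_eq (can_inj fK)) /=.
rewrite (inj_eq enum_rank_inj) rt_eq /=.
by case: eqVneq => [->|]; rewrite ?adj_irr // andbT.
Qed.

(** Complementation turns the independent part into a clique, and the transitivity of adjacency in a
    cluster into the condition of [multipartite]. *)
Lemma monopolarE (G : sgraph) : monopolar G <-> @polar (compl G) setT.
Proof.
split.
- case=> A [B [AB _ iA cB]]; exists A, B; rewrite AB; split=> //.
  + by move=> x y xA yA xy; rewrite /= xy (iA _ _ xA yA).
  + have tr (x y z : G) : x \in B -> y \in B -> z \in B ->
        adj x y -> adj y z -> x != z -> adj x z.
      move=> xB yB zB.
      exact: (@cluster_trans (induced B) (Sub x xB) (Sub y yB) (Sub z zB) cB).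
    move=> x y z xB yB zB /= /andP[xy nxy]; apply: contraR nxy.
    rewrite negb_or !negb_and !negbK.
    have [<-|nxz] := eqVneq x z; have [yx|nyz] := eqVneq y _ => //=.
    * by rewrite yx eqxx in xy.
    * by rewrite adj_sym.
    * by rewrite yx andbT.
    * by move=> /andP[xz yz]; apply: (tr x z y) => //; rewrite adj_sym.
- case=> K [M [/subsetP cov cK mM]].
  (* [K] and [M] may overlap; the complement of [K] lies inside [M] and restores a partition. *)
  exists K, (~: K); split; [exact: setUCr | exact: setICr | |].
  + move=> x y xK yK; apply/negP => xy.
    by have := cK _ _ xK yK (adj_neq xy); rewrite /= xy andbF.
  + apply: trans_cluster => x y z xy yz nxz.
    have hM (w : induced (~: K)) : val w \in M.
      by have := cov (val w) (in_setT _); have := valP w; rewrite !inE => /negPf->.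
    have := mM _ _ _ (hM x) (hM z) (hM y).
    move: xy yz nxz => /= xy yz; rewrite -(inj_eq val_inj) => -> /=.
    rewrite xy [adj (val z) _]adj_sym yz !andbF /= => h.
    by apply/negPn/negP => /h.
Qed.

Lemma polar_preim (F H : sgraph) (f : F -> H) (S : {set H}) :
  injective f -> {mono f : x y / adj x y} -> polar S -> polar (f @^-1: S).
Proof.
move=> fi fm [K [M [/subsetP cov cK mM]]]; exists (f @^-1: K), (f @^-1: M).
split.
- by apply/subsetP=> x; rewrite !inE => /cov; rewrite inE.
- by move=> x y; rewrite !inE -fm => xK yK xy; apply: cK => //; rewrite (inj_eq fi).
- by move=> x y z; rewrite !inE -!fm => *; apply: mM.
Qed.

Lemma polar_imset (F H : sgraph) (f : F -> H) :
  {mono f : x y / adj x y} -> polar [set: F] -> polar (f @: [set: F]).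
Proof.
move=> fm [K [M [/subsetP cov cK mM]]]; exists (f @: K), (f @: M); split.
- apply/subsetP=> _ /imsetP[x /cov + ->]; rewrite !inE.
  by case/orP=> h; rewrite (imset_f f h) ?orbT.
- move=> _ _ /imsetP[x xK ->] /imsetP[y yK ->] nxy; rewrite fm; apply: cK => //.
  by apply: contraNneq nxy => ->.
- move=> _ _ _ /imsetP[x xM ->] /imsetP[y yM ->] /imsetP[z zM ->].
  by rewrite !fm; apply: mM.
Qed.

Lemma polarS (H : sgraph) (S T : {set H}) : S \subset T -> polar T -> polar S.
Proof.
move=> ST [K [M [cov ? ?]]]; exists K, M; split=> //.
exact: subset_trans ST cov.
Qed.

Lemma iso_minimal_nonpolar (F H : sgraph) :
  iso H F -> minimal_nonpolar F -> minimal_nonpolar H.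
Proof.
case=> f [g fK gK] fm [nF mF].
have gm : {mono g : x y / adj x y} by move=> x y; rewrite -fm !gK.
split=> [/(polar_preim (can_inj gK) gm)|S].
  by rewrite preimsetT.
rewrite properT => /eqP nS.
have -> : S = f @^-1: (g @^-1: S) by apply/setP=> x; rewrite !inE fK.
apply: (polar_preim (can_inj fK) fm); apply: mF; rewrite properT.
apply/eqP => e; apply: nS; apply/setP=> x.
by have := in_setT (f x); rewrite -e !inE fK.
Qed.

Lemma monopolar_induced (G : sgraph) (S : {set G}) :
  monopolar (induced S) <-> @polar (compl G) S.
Proof.
pose f (x : compl (induced S)) : compl G := val x.
have fi : injective f := val_inj.
have fm : {mono f : x y / adj x y} by move=> x y; rewrite /= -(inj_eq val_inj).
split=> [/monopolarE/(polar_imset fm)|/(polar_preim fi fm) p]; last first.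
  apply/monopolarE; apply: polarS p.
  by apply/subsetP=> x _; rewrite inE (valP x).
apply: polarS.
by apply/subsetP=> x xS; apply/imsetP; exists (Sub x xS); rewrite /f ?SubK.
Qed.

Lemma minimal_monopolarE (G : sgraph) :
  minimal_monopolar_obstruction G <-> minimal_nonpolar (compl G).
Proof.
split=> -[nP mP]; split=> [/monopolarE//|S pS];
  exact/monopolar_induced/mP.
Qed.

(** * Graphs given by an adjacency table *)

(* Row i lists the adjacencies of vertex i with the vertices j < i. *)
Definition entry (E : seq (seq bool)) (i j : nat) : bool :=
  nth false (nth [::] E i) j.

Definition pat_adj (E : seq (seq bool)) : rel nat :=
  fun i j => (j < i) && entry E i j || (i < j) && entry E j i.

Lemma pat_sym (E : seq (seq bool)) :
  symmetric (fun i j : 'I_(size E) => pat_adj E i j).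
Proof. by move=> i j; rewrite /pat_adj orbC. Qed.

Lemma pat_irr (E : seq (seq bool)) :
  irreflexive (fun i j : 'I_(size E) => pat_adj E i j).
Proof. by move=> i; rewrite /pat_adj ltnn. Qed.

Definition pat (E : seq (seq bool)) : sgraph :=
  SGraph (@pat_sym E) (@pat_irr E).

(** A computable test that [vs] lists, in order, an induced copy of the tabled graph; pairs j < i
    suffice by symmetry. The head of [vs] doubles as the default of [nth], so the empty list fits
    nothing. *)
Definition fits (H : sgraph) (E : seq (seq bool)) (vs : seq H) : bool :=
  if vs is x0 :: _ then
    [&& size vs == size E, uniq vs &
      all (fun i => all (fun j => adj (nth x0 vs i) (nth x0 vs j) == entry E i j)
                        (iota 0 i)) (iota 0 (size E))]
  else false.

Lemma fits_embed (H : sgraph) (E : seq (seq bool)) (vs : seq H) :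
  fits E vs ->
  exists2 f : pat E -> H, injective f & {mono f : x y / adj x y}.
Proof.
case: vs => // x0 vs0; rewrite /fits; set vs := x0 :: vs0 => /and3P[/eqP sz un].
move=> /allP ch; exists (fun i : pat E => nth x0 vs (i : 'I_(size E))).
  move=> i j /eqP; rewrite nth_uniq ?sz ?ltn_ord // => /eqP e; exact: val_inj.
have lt (i j : 'I_(size E)) : j < i -> adj (nth x0 vs i) (nth x0 vs j) = entry E i j.
  move=> ji; have := ch i; rewrite mem_iota ltn_ord => /(_ isT)/allP/(_ j).
  by rewrite mem_iota ji => /(_ isT)/eqP.
move=> i j; rewrite [RHS]/(pat_adj E (i : 'I_(size E)) (j : 'I_(size E))).
rewrite /pat_adj; case: (ltngtP j i) => h /=.
- by rewrite lt // orbF.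
- by rewrite adj_sym lt.
- by rewrite h adj_irr.
Qed.

Lemma fits_iso (H : sgraph) (E : seq (seq bool)) (vs : seq H) :
  #|H| = size E -> fits E vs -> iso (pat E) H.
Proof.
move=> cH /fits_embed[f fi fm]; exists f => //.
by apply: inj_card_bij fi _; rewrite cH [X in _ <= X]card_ord.
Qed.

(** The image of F is a nonpolar vertex set, so it cannot be proper in a minimal H. *)
Lemma minimal_embed (F H : sgraph) (f : F -> H) :
  injective f -> {mono f : x y / adj x y} -> ~ polar [set: F] ->
  minimal_nonpolar H -> iso H F.
Proof.
move=> fi fm nF [_ mH]; apply: iso_sym; exists f => //.
have eT : f @: setT = setT.
  apply/eqP/negPn; rewrite -properT; apply/negP => /mH.
  move/(polar_preim fi fm) => h; apply: nF; apply: polarS h.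
  by apply/subsetP=> x _; rewrite inE imset_f.
apply: inj_card_bij fi _.
by rewrite -[#|H|]cardsT -eT -[#|F|]cardsT leq_imset_card.
Qed.

Fixpoint masks (n : nat) : seq bitseq :=
  if n is n'.+1 then
    [seq true :: m | m <- masks n'] ++ [seq false :: m | m <- masks n']
  else [:: [::]].

Lemma mem_masks (m : bitseq) : m \in masks (size m).
Proof.
elim: m => //= b m IH; rewrite mem_cat; apply/orP; case: b; [left|right];
  exact: map_f.
Qed.

(** The bits of [m] mark the clique within the vertex list [l]; the unmarked vertices of [l] form
    the multipartite part. *)
Definition polar_mask (E : seq (seq bool)) (l : seq nat) (m : bitseq) : bool :=
  all (fun i => all (fun j =>
    if nth false m i then nth false m j ==> (i == j) || pat_adj E i j
    else ~~ nth false m j && pat_adj E i j ==>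
         all (fun k => nth false m k || pat_adj E i k || pat_adj E j k) l) l) l.

(** Deleting single vertices is enough, since a proper vertex set misses some vertex and polarity
    passes to subsets. *)
Definition obstructs (E : seq (seq bool)) : bool :=
  let n := size E in
  all (fun m => ~~ polar_mask E (iota 0 n) m) (masks n) &&
  all (fun v => has (polar_mask E (rem v (iota 0 n))) (masks n)) (iota 0 n).

Lemma obstructsP (E : seq (seq bool)) :
  obstructs E -> minimal_nonpolar (pat E).
Proof.
pose n := size E; pose val (i : pat E) : nat := (i : 'I_n).
case/andP=> /allP no /allP yes; split=> [[K [M [/subsetP cov cK mM]]]|S].
- pose m := [seq if insub i is Some v then (v : pat E) \in K else false | i <- iota 0 n].
  have mE (i : pat E) : nth false m (val i) = (i \in K).
    rewrite (nth_map 0) ?size_iota ?ltn_ord // nth_iota ?ltn_ord //.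
    by rewrite valK.
  have mm : m \in masks n by rewrite -[n](size_iota 0) -(size_map _ _ : size m = _) mem_masks.
  apply/negP: (no m mm); apply/negPn.
  have inj x : x \in iota 0 n -> exists i : pat E, val i = x.
    by rewrite mem_iota => /= xn; exists (Ordinal xn : 'I_n).
  have Mn i : i \notin K -> i \in M.
    by have := cov i (in_setT _); rewrite inE => /orP[->|].
  apply/allP=> _ /inj[i <-]; apply/allP=> _ /inj[j <-]; rewrite !mE.
  case: ifPn => iK; apply/implyP.
    by move=> jK; have [->|ne] := eqVneq i j; [rewrite eqxx | apply/orP; right; exact: cK].
  case/andP=> jK ij; apply/allP=> _ /inj[k <-]; rewrite mE.
  have [//|kK /=] := boolP (k \in K).
  exact: (mM i j k (Mn _ iK) (Mn _ jK) (Mn _ kK) ij).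
- rewrite properE subsetT /= => /subsetPn[v _ vS].
  have vn : val v \in iota 0 n by rewrite mem_iota ltn_ord.
  have /hasP[m _ /allP ch] := yes _ vn.
  have inl i : i \in S -> val i \in rem (val v) (iota 0 n).
    move=> iS; rewrite mem_rem_uniq ?iota_uniq // inE mem_iota ltn_ord andbT.
    by rewrite andbT; apply: contraNneq vS => /ord_inj <-.
  pose K := [set i : pat E | nth false m (val i)].
  exists (S :&: K), (S :\: K); split; first by rewrite setID.
  + move=> i j; rewrite !inE => /andP[/inl il iK] /andP[/inl jl jK] ij.
    have /allP/(_ _ jl) := ch _ il; rewrite iK jK /=.
    by case: eqP => // /ord_inj e; rewrite e eqxx in ij.
  + move=> i j k; rewrite !inE => /andP[iK /inl il] /andP[jK /inl jl].
    move=> /andP[/negPf kK /inl kl] ij.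
    have /allP/(_ _ jl) := ch _ il; rewrite (negPf iK) jK [pat_adj _ _ _]ij /=.
    by move=> /allP/(_ _ kl); rewrite kK.
Qed.

(** * The seven obstructions as tables *)

Definition pK1_2K2 : seq (seq bool) :=
  [:: [::]; [:: true]; [:: false; false]; [:: false; false; true]; nseq 4 false].
Definition p2P3 : seq (seq bool) :=
  [:: [::]; [:: true]; [:: false; true]; nseq 3 false;
      [:: false; false; false; true]; [:: false; false; false; false; true]].
Definition pK1_C5 : seq (seq bool) :=
  [:: [::]; [:: true]; [:: false; true]; [:: false; false; true];
      [:: true; false; false; true]; nseq 5 false].
(** A C_4 on 0, 1, 2, 3, a fifth vertex whose adjacencies to it are the row [r], and an isolated
    vertex. Four of the seven graphs have this shape. *)
Definition pK1_C4 (r : seq bool) : seq (seq bool) :=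
  [:: [::]; [:: true]; [:: false; true]; [:: true; false; true]; r; nseq 5 false].

Definition in_copy (n : nat) (G : sgraph) (i : 'I_n) (x : G) : copies n G :=
  existT (fun=> G : Type) i x.

Lemma in_copy_adj (n : nat) (G : sgraph) (i j : 'I_n) (x y : G) :
  adj (in_copy i x) (in_copy j y) = (i == j) && adj x y.
Proof.
rewrite [LHS]/(bigunion_adj _ _) /bigunion_adj /=; case: eqVneq => //= e.
by case: j / e; rewrite tagged_asE.
Qed.

Lemma in_copy_eq (n : nat) (G : sgraph) (i j : 'I_n) (x y : G) :
  (in_copy i x == in_copy j y) = (i == j) && (x == y).
Proof.
rewrite -tag_eqE /tag_eq /=; case: eqVneq => //= e.
by case: j / e; rewrite tagged_asE.
Qed.

Lemma card_copies (n : nat) (G : sgraph) : #|copies n G| = n * #|G|.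
Proof. by rewrite card_tagged sumnE big_map big_enum sum_nat_const card_ord. Qed.

(** A binary sum replaces the dependent one, so that concrete vertices can be listed and [fits]
    evaluated on them. *)
Lemma iso_copies2 (G : sgraph) : iso (copies 2 G) (union G G).
Proof.
apply: iso_sym; exists (fun u : union G G =>
  match u with inl x => @in_copy 2 G ord0 x | inr x => @in_copy 2 G ord_max x end).
  apply: inj_card_bij; last by rewrite card_copies card_sum mul2n addnn.
  by case=> x [] y /eqP; rewrite in_copy_eq //= => /eqP->.
by case=> x [] y; rewrite in_copy_adj.
Qed.

Lemma iso_union (G G' H H' : sgraph) :
  iso G G' -> iso H H' -> iso (union G H) (union G' H').
Proof.
case=> f [f' fK f'K] fm [g [g' gK g'K] gm].
exists (fun u : union G H =>
  match u with inl x => inl (f x) | inr x => inr (g x) end : union G' H').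
  exists (fun u : union G' H' =>
    match u with inl x => inl (f' x) | inr x => inr (g' x) end : union G H).
    by case=> x; rewrite ?fK ?gK.
  by case=> x; rewrite ?f'K ?g'K.
by case=> x [] y //=; rewrite ?fm ?gm.
Qed.

Lemma iso_refl (G : sgraph) : iso G G.
Proof. by exists id => //; exists id. Qed.

Local Notation ord n i := (@Ordinal n i isT).

Lemma iso_K1_2K2 : iso (pat pK1_2K2) (union (complete 1) (copies 2 (complete 2))).
Proof.
apply: (iso_trans _ (iso_union (iso_refl _) (iso_sym (iso_copies2 _)))).
apply: (@fits_iso (union (complete 1) (union (complete 2) (complete 2))) _
  [:: inr (inl (ord 2 0)); inr (inl (ord 2 1));
  inr (inr (ord 2 0)); inr (inr (ord 2 1)); inl (ord 1 0)]) => //.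
by rewrite !card_sum !card_ord.
Qed.

Lemma iso_2P3 : iso (pat p2P3) (copies 2 (path_graph 3)).
Proof.
apply: (iso_trans _ (iso_sym (iso_copies2 _))).
apply: (@fits_iso (union (path_graph 3) (path_graph 3)) _
  [:: inl (ord 3 0); inl (ord 3 1); inl (ord 3 2);
  inr (ord 3 0); inr (ord 3 1); inr (ord 3 2)]) => //.
by rewrite !card_sum !card_ord.
Qed.

Lemma iso_2K1_C4 :
  iso (pat (pK1_C4 (nseq 4 false))) (union (copies 2 (complete 1)) (cycle_graph 4)).
Proof.
apply: (iso_trans _ (iso_union (iso_sym (iso_copies2 _)) (iso_refl _))).
apply: (@fits_iso (union (union (complete 1) (complete 1)) (cycle_graph 4)) _
  [:: inr (ord 4 0); inr (ord 4 1); inr (ord 4 2);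
  inr (ord 4 3); inl (inl (ord 1 0)); inl (inr (ord 1 0))]) => //.
by rewrite !card_sum !card_ord.
Qed.

Lemma iso_K1_coP3K2 :
  iso (pat (pK1_C4 [:: true; true; true; false]))
    (union (complete 1) (compl (union (path_graph 3) (complete 2)))).
Proof.
(* In the complement of P_3+K_2, the vertices of K_2 alternate with an end and the midpoint of P_3
   around a C_4; the other end of P_3 sees all of it but the midpoint. *)
apply: (@fits_iso (union (complete 1) (compl (union (path_graph 3) (complete 2)))) _
  [:: inr (inr (ord 2 0)); inr (inl (ord 3 0));
  inr (inr (ord 2 1)); inr (inl (ord 3 1)); inr (inl (ord 3 2)); inl (ord 1 0)]) => //.
by rewrite !card_sum !card_ord.
Qed.

Lemma iso_K1_C5 : iso (pat pK1_C5) (union (complete 1) (cycle_graph 5)).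
Proof.
apply: (@fits_iso (union (complete 1) (cycle_graph 5)) _
  [:: inr (ord 5 0); inr (ord 5 1); inr (ord 5 2);
  inr (ord 5 3); inr (ord 5 4); inl (ord 1 0)]) => //.
by rewrite !card_sum !card_ord.
Qed.

Lemma iso_K1_banner :
  iso (pat (pK1_C4 [:: true; false; false; false])) (union (complete 1) banner).
Proof.
apply: (@fits_iso (union (complete 1) banner) _
  [:: inr (Some (ord 4 0)); inr (Some (ord 4 1));
  inr (Some (ord 4 2)); inr (Some (ord 4 3)); inr None; inl (ord 1 0)]) => //.
by rewrite !card_sum card_option !card_ord.
Qed.

Lemma iso_K1_house :
  iso (pat (pK1_C4 [:: true; true; false; false]))
    (union (complete 1) (compl (path_graph 5))).
Proof.
(* The middle of P_5 is the roof of the house: in the complement it sees exactly the two ends of the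
   path. *)
apply: (@fits_iso (union (complete 1) (compl (path_graph 5))) _
  [:: inr (ord 5 0); inr (ord 5 4); inr (ord 5 1);
  inr (ord 5 3); inr (ord 5 2); inl (ord 1 0)]) => //.
by rewrite !card_sum !card_ord.
Qed.

Lemma obstructions :
  all obstructs
    [:: pK1_2K2; p2P3; pK1_C5; pK1_C4 (nseq 4 false);
        pK1_C4 [:: true; true; true; false];
        pK1_C4 [:: true; false; false; false];
        pK1_C4 [:: true; true; false; false]].
Proof. by vm_compute. Qed.

(** * Split graphs and joins *)

Ltac facts :=
  repeat match goal with
  | h : is_true (adj ?x ?y) |- context [adj ?x ?y] => rewrite h
  | h : is_true (adj ?x ?y) |- context [adj ?y ?x] => rewrite [adj y x]adj_sym h
  | h : is_true (~~ adj ?x ?y) |- context [adj ?x ?y] => rewrite (negPf h)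
  | h : is_true (~~ adj ?x ?y) |- context [adj ?y ?x] =>
      rewrite [adj y x]adj_sym (negPf h)
  | h : adj ?x ?y = _ |- context [adj ?x ?y] => rewrite h
  | h : adj ?x ?y = _ |- context [adj ?y ?x] => rewrite [adj y x]adj_sym h
  | |- context [adj ?x ?x] => rewrite adj_irr
  | h : is_true (?x != ?y) |- context [?x == ?y] => rewrite (negPf h)
  | h : is_true (?x != ?y) |- context [?y == ?x] => rewrite [y == x]eq_sym (negPf h)
  | h : is_true (adj ?x ?y) |- context [?x == ?y] => rewrite (negPf (adj_neq h))
  | h : is_true (adj ?x ?y) |- context [?y == ?x] =>
      rewrite [y == x]eq_sym (negPf (adj_neq h))
  end.

Definition is_split (H : sgraph) (S : {set H}) : Prop :=
  exists K I : {set H}, [/\ S \subset K :|: I, clique K & independent I].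

Lemma split_polar (H : sgraph) (S : {set H}) : is_split S -> polar S.
Proof.
case=> K [I [cov cK iI]]; exists K, I; split=> // x y z xI yI _ xy.
by have := iI _ _ xI yI; rewrite xy.
Qed.

Definition c4 (H : sgraph) (a b c d : H) : bool :=
  [&& adj a b, adj b c, adj c d, adj d a, ~~ adj a c, ~~ adj b d, a != c & b != d].

Definition two_k2 (H : sgraph) (a b c d : H) : bool :=
  [&& adj a b, adj c d, ~~ adj a c, ~~ adj a d, ~~ adj b c & ~~ adj b d].

Definition c5 (H : sgraph) (a b c d e : H) : bool :=
  [&& adj a b, adj b c, adj c d, adj d e & adj e a] &&
  [&& ~~ adj a c, ~~ adj a d, ~~ adj b d, ~~ adj b e & ~~ adj c e].

Lemma cliqueU1 (H : sgraph) (K : {set H}) (x : H) :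
  clique K -> {in K, forall k, adj x k} -> clique (x |: K).
Proof.
move=> cK xK y z; rewrite !inE => /predU1P[->|yK] /predU1P[->|zK] yz.
- by rewrite eqxx in yz.
- exact: xK.
- by rewrite adj_sym xK.
- exact: cK.
Qed.

Lemma cliqueS (H : sgraph) (K L : {set H}) : K \subset L -> clique L -> clique K.
Proof. by move=> /subsetP KL cL x y /KL xL /KL yL; apply: cL. Qed.

Lemma cliqueP (H : sgraph) (K : {set H}) :
  reflect (clique K) [forall x in K, forall y in K, (x != y) ==> adj x y].
Proof.
apply: (iffP forall_inP) => cK x.
  by move=> y xK yK; apply/implyP; move: y yK; apply/forall_inP/cK.
by move=> xK; apply/forall_inP=> y yK; apply/implyP; apply: cK.
Qed.

(* A clique of maximum size and, subject to that, of maximum degree sum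
   leaves the fewest edges outside; an outside edge then yields an obstruction. *)
Lemma foldes_hammer (H : sgraph) :
  (forall a b c d : H, ~~ c4 a b c d) ->
  (forall a b c d : H, ~~ two_k2 a b c d) ->
  (forall a b c d e : H, ~~ c5 a b c d e) -> is_split [set: H].
Proof.
move=> no4 no22 no5.
pose cl (K : {set H}) := [forall x in K, forall y in K, (x != y) ==> adj x y].
have cl0 : cl set0 by apply/cliqueP => x y; rewrite inE.
case: (arg_maxnP (fun K : {set H} => #|K|) cl0) => K0 cK0 maxK0.
pose deg (x : H) := #|[set y | adj x y]|.
pose mc (K : {set H}) := cl K && (#|K| == #|K0|).
have clK0 : mc K0 by rewrite /mc cK0 eqxx.
case: (arg_maxnP (fun K : {set H} => \sum_(k in K) deg k) clK0).
move=> K /andP[/cliqueP cK /eqP szK] maxK.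
have max_card (L : {set H}) : clique L -> #|L| <= #|K|.
  by move=> /cliqueP cL; rewrite szK; exact: (maxK0 L cL).
have max_deg (L : {set H}) : clique L -> #|L| = #|K| ->
    \sum_(k in L) deg k <= \sum_(k in K) deg k.
  move=> /cliqueP cL eL; apply: (maxK L).
  by rewrite /mc eL szK eqxx andbT.
exists K, (~: K); split=> //; first by rewrite setUCr.
move=> x y; rewrite !inE => xK yK; apply/negP => xy.
have nonnbr v : v \notin K -> exists2 k, k \in K & ~~ adj v k.
  move=> vK; apply/exists_inP; rewrite -negb_forall_in; apply/negP=> /forall_inP h.
  by have := max_card _ (cliqueU1 cK h); rewrite cardsU1 vK ltnn.
(* If both cross edges uq and vp are present, u v p q is a C_4; if both are absent, uv and pq form a
   2K_2. *)
have xor u v p q : u \notin K -> v \notin K -> adj u v ->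
    p \in K -> q \in K -> p != q -> ~~ adj u p -> ~~ adj v q -> adj u q != adj v p.
  move=> uK vK uv pK qK pq up vq; apply/negP => /eqP e.
  have := no4 u v p q; have := no22 u v p q; rewrite /c4 /two_k2 uv up vq cK //.
  rewrite -e [adj q u]adj_sym; case: (adj u q) => //= _ /negP; apply.
  by apply/andP; split; [apply: contraNneq uK|apply: contraNneq vK] => ->.
pose nn v := [set k in K | ~~ adj v k].
(* By [xor] the sets of vertices of [K] missed by x and by y are nested. *)
wlog sub : x y xK yK xy / nn y \subset nn x.
  move=> hw; have [/(hw x y)|/subsetPn[q]] := boolP (nn y \subset nn x); first exact.
  rewrite !inE => /andP[qK yq]; rewrite qK negbK /= => xq.
  apply: (hw y x) => //; first by rewrite adj_sym.
  apply/subsetP=> p; rewrite !inE => /andP[pK xp]; rewrite pK /=.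
  have pq : p != q by apply: contraNneq xp => ->.
  by have := xor x y p q xK yK xy pK qK pq xp yq; rewrite xq; case: (adj y p).
have [z zK yz] := nonnbr y yK.
have nx q : q \in K -> ~~ adj y q -> ~~ adj x q.
  by move=> qK yq; have := subsetP sub q; rewrite !inE qK yq /= => /(_ isT).
have xz := nx z zK yz.
(* As x misses whatever y misses in [K], a second vertex missed by y would give, with z and the edge
   xy, a 2K_2. Hence y can be exchanged for z in the clique. *)
have yN k : k \in K -> k != z -> adj y k.
  move=> kK kz; apply: contraT => yk; rewrite eq_sym in kz.
  by have := xor x y z k xK yK xy zK kK kz xz yk; rewrite (negPf (nx k kK yk)) (negPf yz).
have cKy : clique (y |: K :\ z).
  apply: cliqueU1; first exact: cliqueS (subsetDl _ _) cK.
  by move=> k; rewrite !inE => /andP[kz kK]; apply: yN.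
have yKz : y \notin K :\ z by rewrite !inE (negPf yK) andbF.
have szKy : #|y |: K :\ z| = #|K| by rewrite cardsU1 yKz (cardsD1 z K) zK.
have degyz : deg y <= deg z.
  have := max_deg _ cKy szKy; rewrite big_setU1 // [X in _ <= X](big_setD1 z) //=.
  by rewrite leq_add2r.
(* The exchange does not raise the degree sum, so y has degree at most that of z; since x sees y but
   not z, some w sees z but not y. *)
have /subsetPn[w] : ~~ ([set u | adj z u] \subset [set u | adj y u]).
  apply/negP => sb; have /eqP e : [set u | adj z u] == [set u | adj y u].
    by rewrite eqEcard sb.
  have : x \in [set u | adj z u] by rewrite e inE adj_sym.
  by rewrite inE adj_sym (negPf xz).
rewrite !inE => zw yw.
have xw : adj x w.
  by have := no22 x y w z; rewrite /two_k2; facts; rewrite /= andbT negbK.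
(* Otherwise w x y k is a C_4 or z w x y k a C_5, according to whether w sees k. Adding x after the
   exchange then gives a clique larger than the maximum. *)
have xN k : k \in K -> k != z -> adj x k.
  move=> kK kz; apply: contraT => xk; have yk := yN k kK kz.
  have kz' := cK _ _ kK zK kz.
  case wk : (adj w k).
    have := no4 w x y k; rewrite /c4; facts; rewrite /= negb_and !negbK.
    by case/orP=> /eqP e; [rewrite e adj_sym (negPf yz) in zw | rewrite e kK in xK].
  by have := no5 z w x y k; rewrite /c5; facts.
have := max_card (x |: (y |: K :\ z)).
rewrite cardsU1 szKy !inE (negPf xK) andbF orbF (negPf (adj_neq xy)) ltnn.
move=> big; suff : false by []; apply: big.
apply: cliqueU1 => // k; rewrite !inE => /predU1P[->//|/andP[kz kK]]; exact: xN.
Qed.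

Lemma join_polar (H : sgraph) (X : {set H}) :
  {in X & ~: X, forall x y, adj x y} -> polar X -> polar (~: X) -> polar [set: H].
Proof.
move=> XY [K [M [/subsetP cX cK mM]]] [K' [M' [/subsetP cY cK' mM']]].
have XY' : {in ~: X & X, forall x y, adj x y}.
  by move=> x y xX yX; rewrite adj_sym XY.
exists (K :&: X :|: K' :\: X), (M :&: X :|: M' :\: X); split.
- apply/subsetP=> x _; have := cX x; have := cY x; rewrite !inE.
  by case: (x \in X) => h1 h2; rewrite /= ?andbT ?andbF ?orbF /=; [apply: h2|apply: h1].
- move=> x y; rewrite !inE => /orP[]/andP[h1 h2] /orP[]/andP[h3 h4] xy.
  + exact: cK.
  + by apply: XY; rewrite ?inE.
  + by apply: XY'; rewrite ?inE.
  + exact: cK'.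
- move=> x y z; rewrite !inE => /orP[]/andP[h1 h2] /orP[]/andP[h3 h4] /orP[]/andP[h5 h6].
  + exact: mM.
  + by rewrite (XY x z) ?inE.
  + by rewrite (XY' y z) ?inE ?orbT.
  + by rewrite (XY x z) ?inE.
  + by rewrite (XY' x z) ?inE.
  + by rewrite (XY y z) ?inE ?orbT.
  + by rewrite (XY' y z) ?inE ?orbT.
  + exact: mM'.
Qed.

(** * Separable graphs *)

Ltac distinct :=
  apply/negP => /eqP ?; subst;
  match goal with
  | h : is_true (adj ?x ?y), g : is_true (~~ adj ?x ?y) |- _ => by rewrite h in g
  | h : is_true (adj ?x ?y), g : is_true (~~ adj ?y ?x) |- _ =>
      by rewrite adj_sym h in g
  | h : is_true (adj ?x ?x) |- _ => by rewrite adj_irr in h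
  end.

Ltac fit :=
  rewrite /fits /= !inE; facts;
  repeat (match goal with
  | |- context [?x == ?y] => is_var x; is_var y;
      let h := fresh "h" in assert (h : x != y) by distinct; rewrite (negPf h)
  end); by [].

Definition obstruction_patterns : seq (seq (seq bool)) :=
  [:: pK1_2K2; p2P3; pK1_C5; pK1_C4 (nseq 4 false);
      pK1_C4 [:: true; true; true; false];
      pK1_C4 [:: true; false; false; false];
      pK1_C4 [:: true; true; false; false]].

Definition obstruction_free (H : sgraph) : Prop :=
  forall (E : seq (seq bool)) (vs : seq H),
  E \in obstruction_patterns -> ~~ fits E vs.

Ltac try_fit fr r vs := apply: (negP (fr (pK1_C4 r) vs isT)); fit.

Definition apart (H : sgraph) (w v : H) : bool := ~~ adj v w && (v != w).

(** With w as isolated vertex, a vertex v off the cycle that sees none, one, two consecutive or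
    three of its vertices yields respectively 2K_1+C_4, K_1+P, K_1 plus a house, or K_1 plus the
    complement of P_3+K_2; the trials run through the rotations. What is left is an opposite pair or
    all four. *)
Lemma c4_type (H : sgraph) (a b c d w v : H) :
  obstruction_free H -> c4 a b c d -> all (apart w) [:: a; b; c; d; v] ->
  [/\ adj v a = adj v c, adj v b = adj v d & adj v a || adj v b].
Proof.
move=> fr; rewrite /c4 => /and5P[ab bc cd da /and4P[ac bd nac nbd]].
move=> /and5P[/andP[aw naw] /andP[bw nbw] /andP[cw ncw] /andP[dw ndw]].
rewrite /= andbT => /andP[vw nvw].
have [->|nva] := eqVneq v a; first by split; facts.
have [->|nvb] := eqVneq v b; first by split; facts.
have [->|nvc] := eqVneq v c; first by split; facts.
have [->|nvd] := eqVneq v d; first by split; facts.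
case va: (adj v a); case vb: (adj v b); case vc: (adj v c); case vd: (adj v d) => //;
  exfalso.
all: first [
  try_fit fr (nseq 4 false) [:: a; b; c; d; v; w]
| try_fit fr [:: true; false; false; false] [:: a; b; c; d; v; w]
| try_fit fr [:: true; false; false; false] [:: b; c; d; a; v; w]
| try_fit fr [:: true; false; false; false] [:: c; d; a; b; v; w]
| try_fit fr [:: true; false; false; false] [:: d; a; b; c; v; w]
| try_fit fr [:: true; true; false; false] [:: a; b; c; d; v; w]
| try_fit fr [:: true; true; false; false] [:: b; c; d; a; v; w]
| try_fit fr [:: true; true; false; false] [:: c; d; a; b; v; w]
| try_fit fr [:: true; true; false; false] [:: d; a; b; c; v; w]
| try_fit fr [:: true; true; true; false] [:: a; b; c; d; v; w]
| try_fit fr [:: true; true; true; false] [:: b; c; d; a; v; w]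
| try_fit fr [:: true; true; true; false] [:: c; d; a; b; v; w]
| try_fit fr [:: true; true; true; false] [:: d; a; b; c; v; w]].
Qed.

(** [X] is a union of components, neither empty nor everything. The two sides of such a cut play the
    role of components throughout. *)
Definition separates (H : sgraph) (X : {set H}) : Prop :=
  [/\ X != set0, ~: X != set0 & forall x y, adj x y -> (x \in X) = (y \in X)].

Lemma separates_outside (H : sgraph) (X : {set H}) (a : H) :
  separates X -> exists w, forall v, (v \in X) = (a \in X) -> apart w v.
Proof.
case=> /set0Pn[x xX] /set0Pn[y yX] sep; rewrite inE in yX.
have [w wa] : exists w, (w \in X) != (a \in X).
  by case: (a \in X); [exists y; rewrite (negPf yX) | exists x; rewrite xX].
exists w => v va; rewrite eq_sym -va in wa; apply/andP; split.
  by apply: contra wa => /sep ->.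
by apply: contraNneq wa => ->.
Qed.

Lemma separates_apart (H : sgraph) (X : {set H}) (v w : H) :
  separates X -> (v \in X) != (w \in X) -> apart w v.
Proof.
case=> _ _ sep vw; apply/andP; split; first by apply: contra vw => /sep->.
by apply: contraNneq vw => ->.
Qed.

Lemma separable_c4_polar (H : sgraph) (X : {set H}) (a b c d : H) :
  obstruction_free H -> separates X -> c4 a b c d -> polar [set: H].
Proof.
move=> fr sX abcd; have [w out] := separates_outside a sX.
have [_ _ sep] := sX; pose S v := (v \in X) = (a \in X).
have := abcd => /and5P[ab bc cd da /and4P[ac bd nac nbd]].
have Sa : S a by []. have Sb : S b by rewrite /S (sep _ _ ab).
have Sc : S c by rewrite /S -(sep _ _ bc). have Sd : S d by rewrite /S (sep _ _ da).
have type p q r s v : c4 p q r s -> S p -> S q -> S r -> S s -> S v ->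
    [/\ adj v p = adj v r, adj v q = adj v s & adj v p || adj v q].
  move=> pqrs Sp Sq Sr Ss Sv; apply: (@c4_type _ p q r s w v) => //.
  by rewrite /= !out.
have via p q r s v : c4 p q r s -> S p -> S q -> S r -> S s -> S v ->
    adj v p -> ~~ adj v r -> False.
  move=> h Sp Sq Sr Ss Sv vp; have [<-] := type _ _ _ _ v h Sp Sq Sr Ss Sv.
  by rewrite vp.
have tQ v := type _ _ _ _ v abcd Sa Sb Sc Sd.
(* If q missed a, it would miss c and see b and d, so it could replace c in the cycle; on the C_4 a
   b q d, p sees a but not the opposite vertex q. *)
have same_a p q : S p -> S q -> ~~ adj p q -> adj p a -> adj q a.
  move=> Sp Sq pq pa; apply: contraT => qa; exfalso.
  have [qc qd qb] := tQ q Sq; rewrite (negPf qa) /= in qb qc; rewrite qb in qd.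
  apply: (@via a b q d p) => //; rewrite /c4.
  have aq : a != q by distinct.
  by symmetry in qd; facts.
have same_b p q : S p -> S q -> ~~ adj p q -> adj p b -> adj q b.
  move=> Sp Sq pq pb; apply: contraT => qb; exfalso.
  have [qc qd qa] := tQ q Sq; rewrite (negPf qb) orbF in qa qd; rewrite qa in qc.
  apply: (@via b c q a p) => //; rewrite /c4.
  have bq : b != q by distinct.
  by symmetry in qc; facts.
exists (~: [set v | (v \in X) == (a \in X)]), [set v | (v \in X) == (a \in X)].
split; first by rewrite setUC setUCr.
(* Two non-adjacent vertices on the other side would complete 2K_1+C_4. *)
- move=> p q; rewrite !inE => /eqP Sp /eqP Sq pq; apply: contraT => npq; exfalso.
  have ap u v : S u -> ~ S v -> apart v u.
    by move=> Su Sv; apply: (separates_apart sX); rewrite Su eq_sym; apply/eqP.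
  have [/andP[? ?] /andP[? ?]] := (ap _ _ Sa Sp, ap _ _ Sa Sq).
  have [/andP[? ?] /andP[? ?]] := (ap _ _ Sb Sp, ap _ _ Sb Sq).
  have [/andP[? ?] /andP[? ?]] := (ap _ _ Sc Sp, ap _ _ Sc Sq).
  have [/andP[? ?] /andP[? ?]] := (ap _ _ Sd Sp, ap _ _ Sd Sq).
  by try_fit fr (nseq 4 false) [:: a; b; c; d; p; q].
(* For an edge xy missed by z, x is made opposite to a, b or z in a new C_4; y sees x but not that
   opposite vertex, against the type of y. *)
- move=> x y z; rewrite !inE => /eqP Sx /eqP Sy /eqP Sz xy; apply: contraT.
  rewrite negb_or => /andP[xz yz]; exfalso.
  have zx : ~~ adj z x by rewrite adj_sym.
  have zy : ~~ adj z y by rewrite adj_sym.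
  have [xc xd xo] := tQ x Sx; have [zc zd zo] := tQ z Sz.
  have [za|za] := boolP (adj z a); last first.
    have xa : ~~ adj x a by apply: contra za; apply: same_a.
    have ya : ~~ adj y a by apply: contra za; apply: same_a.
    rewrite (negPf xa) /= in xo xc; rewrite xo in xd.
    apply: (@via x b a d y) => //; last by rewrite adj_sym.
    have ax : a != x by distinct.
    by rewrite /c4; symmetry in xd; facts.
  have [zb|zb] := boolP (adj z b); last first.
    have xb : ~~ adj x b by apply: contra zb; apply: same_b.
    have yb : ~~ adj y b by apply: contra zb; apply: same_b.
    rewrite (negPf xb) orbF in xo xd; rewrite xo in xc.
    apply: (@via x c b a y) => //; last by rewrite adj_sym.
    have bx : b != x by distinct.
    by rewrite /c4; symmetry in xc; facts.
  have xa := same_a _ _ Sz Sx zx za.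
  rewrite xa in xc; rewrite za in zc; symmetry in xc, zc.
  apply: (@via x a z c y) => //; last by rewrite adj_sym.
  have nxz : x != z by distinct.
  by rewrite /c4; facts.
Qed.

Lemma not_clique (H : sgraph) (K : {set H}) :
  clique K \/
  exists p q, [/\ p \in K, q \in K, p != q & ~~ adj p q].
Proof.
have [/cliqueP cK|] := boolP [forall x in K, forall y in K, (x != y) ==> adj x y].
  by left.
rewrite negb_forall => /existsP[p]; rewrite negb_imply => /andP[pK].
rewrite negb_forall => /existsP[q]; rewrite !negb_imply => /and3P[qK pq npq].
by right; exists p, q.
Qed.

(** Non-adjacent p and q lie in one part of [M]; the edge ab has an end outside that part, and this
    end sees both. *)
Lemma multipartite_P3 (H : sgraph) (M : {set H}) (a b : H) :
  multipartite M -> a \in M -> b \in M -> adj a b ->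
  clique M \/ exists p m q,
    [/\ p \in M, m \in M & q \in M] /\ [/\ adj m p, adj m q, ~~ adj p q & p != q].
Proof.
move=> mM aM bM ab; have [|[p [q [pM qM npq pq]]]] := not_clique M; first by left.
right; have hp := mM _ _ _ aM bM pM ab; have hq := mM _ _ _ aM bM qM ab.
have [/andP[]|na] := boolP (adj a p && adj a q); first by exists p, a, q.
have [/andP[]|nb] := boolP (adj b p && adj b q); first by exists p, b, q.
case ap: (adj a p) na nb hp; case aq: (adj a q) hq => //= bq _; rewrite ?andbT.
- by have := mM _ _ _ aM pM qM ap; rewrite aq (negPf pq).
- by have := mM _ _ _ aM qM pM aq; rewrite ap adj_sym (negPf pq).
- by rewrite bq andbT => /negPf->.
Qed.

(** Two edges on one side, with a vertex of the other, form K_1+2K_2. With an edge on each side, an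
    edge and a vertex missing it on one side, plus the edge of the other, again form K_1+2K_2, so
    both sides are multipartite; if neither is a clique, each has a P_3 and 2P_3 appears. *)
Lemma separable_two_k2_polar (H : sgraph) (X : {set H}) (a b c d : H) :
  obstruction_free H -> separates X -> two_k2 a b c d -> polar [set: H].
Proof.
move=> fr sX /and5P[ab cd ac ad /andP[bc bd]]; have [_ _ sep] := sX.
have [e|e] := eqVneq (c \in X) (a \in X).
  have [w out] := separates_outside a sX; exfalso.
  have [/andP[? ?] /andP[? ?]] := (out a erefl, out b (esym (sep _ _ ab))).
  have [/andP[? ?] /andP[? ?]] :=
    (out c e, out d (etrans (esym (sep _ _ cd)) e)).
  have ? : a != c by distinct. have ? : a != d by distinct.
  have ? : b != c by distinct. have ? : b != d by distinct.
  apply: (negP (fr pK1_2K2 [:: a; b; c; d; w] isT)); fit.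
pose M v := [set x | (x \in X) == (v \in X)].
have aM : a \in M a by rewrite inE.
have bM : b \in M a by rewrite inE (sep _ _ ab).
have cM : c \in M c by rewrite inE.
have dM : d \in M c by rewrite inE (sep _ _ cd).
have ap u v : u \in M a -> v \in M c -> apart u v /\ apart v u.
  rewrite !inE => /eqP eu /eqP ev; split; apply: (separates_apart sX).
    by rewrite eu ev.
  by rewrite eu ev eq_sym.
have cov : [set: H] = M a :|: M c.
  apply/setP=> x; rewrite !inE.
  by case: (x \in X) (a \in X) (c \in X) e => [] [] [].
have ma : multipartite (M a).
  move=> x y z xM yM zM xy; apply: contraT; rewrite negb_or => /andP[xz yz]; exfalso.
  have [[/andP[? ?] _] [/andP[? ?] _]] := (ap _ _ xM cM, ap _ _ xM dM).
  have [[/andP[? ?] _] [/andP[? ?] _]] := (ap _ _ yM cM, ap _ _ yM dM).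
  have [[/andP[? ?] _] [/andP[? ?] _]] := (ap _ _ zM cM, ap _ _ zM dM).
  apply: (negP (fr pK1_2K2 [:: x; y; c; d; z] isT)); fit.
have mc : multipartite (M c).
  move=> x y z xM yM zM xy; apply: contraT; rewrite negb_or => /andP[xz yz]; exfalso.
  have [[/andP[? ?] _] [/andP[? ?] _]] := (ap _ _ aM xM, ap _ _ bM xM).
  have [[/andP[? ?] _] [/andP[? ?] _]] := (ap _ _ aM yM, ap _ _ bM yM).
  have [[/andP[? ?] _] [/andP[? ?] _]] := (ap _ _ aM zM, ap _ _ bM zM).
  apply: (negP (fr pK1_2K2 [:: x; y; a; b; z] isT)); fit.
have [ka|[p [m [q [[pM mM qM] [mp mq pq npq]]]]]] := multipartite_P3 ma aM bM ab.
  by exists (M a), (M c); rewrite cov.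
have [kc|[p' [m' [q' [[pM' mM' qM'] [mp' mq' pq' npq']]]]]] := multipartite_P3 mc cM dM cd.
  by exists (M c), (M a); rewrite cov setUC.
exfalso.
have [[/andP[? ?] _] [/andP[? ?] _] [/andP[? ?] _]] := And3 (ap _ _ pM pM') (ap _ _ pM mM') (ap _ _ pM qM').
have [[/andP[? ?] _] [/andP[? ?] _] [/andP[? ?] _]] := And3 (ap _ _ mM pM') (ap _ _ mM mM') (ap _ _ mM qM').
have [[/andP[? ?] _] [/andP[? ?] _] [/andP[? ?] _]] := And3 (ap _ _ qM pM') (ap _ _ qM mM') (ap _ _ qM qM').
apply: (negP (fr p2P3 [:: p; m; q; p'; m'; q'] isT)); fit.
Qed.

Lemma separable_polar (H : sgraph) (X : {set H}) :
  obstruction_free H -> separates X -> polar [set: H].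
Proof.
move=> fr sX; have [_ _ sep] := sX.
have [/existsP[a /existsP[b /existsP[c /existsP[d]]]]|no4] :=
  boolP [exists a : H, exists b : H, exists c : H, exists d : H, c4 a b c d].
  exact: separable_c4_polar fr sX.
have [/existsP[a /existsP[b /existsP[c /existsP[d]]]]|no2] :=
  boolP [exists a : H, exists b : H, exists c : H, exists d : H, two_k2 a b c d].
  exact: separable_two_k2_polar fr sX.
apply/split_polar/foldes_hammer.
- move=> a b c d; apply: contra no4 => h.
  by apply/existsP; exists a; apply/existsP; exists b; apply/existsP; exists c;
    apply/existsP; exists d.
- move=> a b c d; apply: contra no2 => h.
  by apply/existsP; exists a; apply/existsP; exists b; apply/existsP; exists c;
    apply/existsP; exists d.
- move=> a b c d e; apply/negP => /andP[/and5P[ab bc cd de ea] /and5P[ac ad bd be ce]].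
  have [w out] := separates_outside a sX.
  have [/andP[? ?] /andP[? ?]] := (out a erefl, out b (esym (sep _ _ ab))).
  have [/andP[? ?] /andP[? ?]] :=
    (out c (esym (etrans (sep _ _ ab) (sep _ _ bc))), out e (sep _ _ ea)).
  have [/andP[? ?] _] := (out d (etrans (sep _ _ de) (sep _ _ ea)), erefl 0).
  apply: (negP (fr pK1_C5 [:: a; b; c; d; e; w] isT)); fit.
Qed.

(** * Induced paths on four vertices *)

Definition p4 (H : sgraph) (a b c d : H) : bool :=
  [&& adj a b, adj b c, adj c d, ~~ adj a c, ~~ adj a d & ~~ adj b d].

(** For [r = false] the subgraph induced on [S] is disconnected, for [r = true] it is a join; one
    parameter lets complementation exchange the two. *)
Definition homogeneous_cut (H : sgraph) (S : {set H}) (r : bool) : Prop :=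
  exists X : {set H}, [/\ X \subset S, X != set0, S :\: X != set0 &
    {in X & S :\: X, forall x y, adj x y = r}].

Lemma compl_cut (H : sgraph) (S : {set H}) (r : bool) :
  @homogeneous_cut (compl H) S r -> homogeneous_cut S (~~ r).
Proof.
case=> X [XS X0 Y0 XY]; exists X; split=> // x y xX yY.
rewrite -(XY x y xX yY) /=; case: eqVneq => [e|_ /=]; last by rewrite negbK.
by move: yY; rewrite inE -e xX.
Qed.

(** P_4 is self-complementary: the complement of the path a b c d is the path b d a c. *)
Lemma compl_p4 (H : sgraph) (a b c d : H) :
  @p4 (compl H) a b c d -> p4 b d a c.
Proof.
rewrite /p4 /= !negb_and !negbK.
move=> /and5P[/andP[nab ab] /andP[nbc bc] /andP[ncd cd] ac /andP[ad bd]].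
have nac : a != c.
  by apply: contraTneq ad => ->; rewrite (negPf ncd).
have nbd : b != d by apply: contraTneq ad => <-; rewrite (negPf nab).
have nad : a != d.
  by apply: contraTneq bd => <-; rewrite eq_sym (negPf nab) adj_sym.
rewrite (negPf nac) (negPf nbd) (negPf nad) /= in ac ad bd.
by rewrite bd adj_sym ad ac adj_sym ab bc adj_sym cd.
Qed.

(** The inductive step of Seinsche's theorem. If v sees all of [S], it is joined to it; otherwise
    some union of components of [S] stays cut off after v is added. *)
Lemma cut_setU1 (H : sgraph) (S : {set H}) (v : H) :
  (forall a b c d : H, ~~ p4 a b c d) -> v \notin S -> homogeneous_cut S false ->
  exists r, homogeneous_cut (v |: S) r.
Proof.
move=> no4 vS [X [XS X0 Y0 XY]].
have [/forall_inP vT|] := boolP [forall x in S, adj v x].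
  exists true, [set v]; split.
  - by rewrite sub1set setU11.
  - by apply/set0Pn; exists v; rewrite inE.
  - have /set0Pn[x xX] := X0; apply/set0Pn; exists x.
    rewrite !inE (subsetP XS _ xX) orbT andbT.
    by apply: contraNneq vS => <-; apply: (subsetP XS).
  - by move=> x y; rewrite !inE => /eqP-> /andP[/negPf->] /=; apply: vT.
rewrite negb_forall_in => /exists_inP[x2 x2S vx2]; exists false.
wlog x2X : X XS X0 Y0 XY / x2 \in X.
  move=> hw; have [x2X|x2X] := boolP (x2 \in X); first exact: (hw X).
  apply: (hw (S :\: X)); rewrite ?subsetDl ?setDDr ?setDv ?set0U //.
  - by rewrite (setIidPr XS).
  - by move=> x y xY; rewrite (setIidPr XS) => yX; rewrite adj_sym XY.
  - by rewrite inE x2X.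
have cut (Z : {set H}) : Z \subset S -> Z != set0 ->
    {in Z, forall z, ~~ adj z v /\ {in S :\: Z, forall y, ~~ adj z y}} ->
    homogeneous_cut (v |: S) false.
  move=> ZS Z0 Zn; exists Z; split=> //.
  - exact: subset_trans ZS (subsetUr _ _).
  - apply/set0Pn; exists v; rewrite !inE eqxx andbT.
    by apply: contra vS; apply: (subsetP ZS).
  - move=> z y zZ; have [zv zS] := Zn z zZ; rewrite !inE => /andP[yZ].
    by case/predU1P=> [->|yS]; apply/negbTE => //; apply: zS; rewrite inE yZ.
have [/exists_inP[y yY vy]|/exists_inPn nY] := boolP [exists y in S :\: X, adj v y].
  (* An edge from z in [Z] to a neighbour u of v in [X] would give the path y v u z, so [Z] is cut
     off from everything else. *)
  pose Z := [set z in X | ~~ adj v z].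
  have [/exists_inP[z zZ /exists_inP[u uX /andP[vu zu]]]|nz] :=
    boolP [exists z in Z, exists u in X, adj v u && adj z u].
    have := no4 y v u z; rewrite inE in zZ; case/andP: zZ => zX vz.
    rewrite /p4 [adj y v]adj_sym vy vu [adj u z]adj_sym zu vz.
    by rewrite ![adj y _]adj_sym (XY u y uX yY) (XY z y zX yY).
  apply: (cut Z).
  - by apply/subsetP=> z; rewrite inE => /andP[/(subsetP XS)].
  - by apply/set0Pn; exists x2; rewrite inE x2X.
  - move=> z zZ; have := zZ; rewrite inE => /andP[zX vz]; split; first by rewrite adj_sym.
    move=> u; rewrite !inE => /andP[uZ uS]; have [uX|uX] := boolP (u \in X).
      rewrite uX /= negbK in uZ; apply: contra nz => zu.
      by apply/exists_inP; exists z => //; apply/exists_inP; exists u; rewrite // uZ.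
    by rewrite XY // inE uX.
apply: (cut (S :\: X)); rewrite ?subsetDl //.
move=> y yY; split; first by rewrite adj_sym; apply: nY.
move=> x; rewrite setDDr setDv set0U (setIidPr XS) => xX.
by rewrite adj_sym XY.
Qed.

(** Vertices are added one at a time. A join cut of the smaller set is an edgeless cut in the
    complement, which is again P_4-free, so the same step applies there. *)
Lemma p4_free_cut (H : sgraph) (S : {set H}) :
  (forall a b c d : H, ~~ p4 a b c d) -> 1 < #|S| ->
  exists r, homogeneous_cut S r.
Proof.
move=> no4; have [n] := ubnP #|S|; elim: n S => // n IH S Sn S1.
have /set0Pn[v vS] : S != set0 by rewrite -card_gt0 ltnW.
have cS : #|S| = #|S :\ v|.+1 by rewrite (cardsD1 v S) vS.
rewrite -(setD1K vS); have vS' : v \notin S :\ v by rewrite !inE eqxx.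
have [/cards1P[u eu]|S'1] := boolP (#|S :\ v| == 1).
  exists (adj u v), [set u]; rewrite eu; split.
  - exact: subsetUr.
  - by apply/set0Pn; exists u; rewrite inE.
  - apply/set0Pn; exists v; rewrite !inE eqxx andbT.
    by apply: contra vS' => vu; rewrite eu inE.
  - by move=> x y; rewrite !inE => /eqP-> /andP[/negPf->]; rewrite orbF => /eqP->.
have lt1 : 1 < #|S :\ v| by rewrite ltn_neqAle eq_sym S'1 -ltnS -cS.
have ltn : #|S :\ v| < n by rewrite -cS -ltnS.
have [[] cut] := IH _ ltn lt1.
- have no4' a b c d : ~~ @p4 (compl H) a b c d.
    by apply/negP => /compl_p4; apply/negP.
  have [|r /compl_cut] := @cut_setU1 (compl H) (S :\ v) v no4' vS'.
    case: cut => X [XS X0 Y0 XY]; exists X; split=> // x y xX yY.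
    by rewrite /= XY // andbF.
  by exists (~~ r).
- exact: cut_setU1.
Qed.

(** * Vertices outside a P_4, in both classes *)

Lemma p4_uniq (H : sgraph) (a b c d : H) : p4 a b c d -> uniq [:: a; b; c; d].
Proof.
move=> /and5P[ab bc cd ac /andP[ad bd]]; rewrite /= !inE !negb_or.
have ? : a != c by distinct.
have ? : a != d by distinct.
have ? : b != d by distinct.
by facts.
Qed.

Lemma p4_induces (H : sgraph) (a b c d : H) :
  p4 a b c d -> induces_P4 [set x in [:: a; b; c; d]].
Proof.
move=> h; have un := p4_uniq h; apply: iso_sym.
have inW (i : 'I_4) : nth a [:: a; b; c; d] i \in [set x in [:: a; b; c; d]].
  by rewrite inE mem_nth.
exists (fun i : path_graph 4 => Sub (nth a [:: a; b; c; d] (i : 'I_4)) (inW i)).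
  apply: inj_card_bij => [i j /(congr1 val)/eqP|].
    by rewrite !SubK nth_uniq ?ltn_ord // => /eqP/ord_inj.
  by rewrite card_sig cardsE (card_uniqP un) [X in _ <= X]card_ord.
move=> i j; transitivity (adj (nth a [:: a; b; c; d] (i : 'I_4))
                              (nth a [:: a; b; c; d] (j : 'I_4))) => //.
move: h => /and5P[ab bc cd ac /andP[ad bd]].
by case: i => [[|[|[|[|//]]]] ?]; case: j => [[|[|[|[|//]]]] ?] /=; facts.
Qed.

(* That is, v sees none of a, b, c, d, all of them, or exactly b and c. *)
Definition p4_type (H : sgraph) (a b c d v : H) : Prop :=
  [/\ adj v a = adj v d, adj v b = adj v c & adj v a -> adj v b].

Ltac try_p4 m x y z :=
  apply: (m x y z); [by rewrite /= !inE !eqxx ?orbT | by rewrite /p4; facts].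

(** Every other adjacency pattern of v puts it on a P_4 with three of a, b, c, d; up to reversal v
    is then the first or second vertex. *)
Lemma p4_typeP (H : sgraph) (a b c d v : H) :
  p4 a b c d ->
  (forall x y z, all (mem [:: a; b; c; d]) [:: x; y; z] ->
     ~~ p4 v x y z && ~~ p4 x v y z) ->
  p4_type a b c d v.
Proof.
move=> /and5P[ab bc cd ac /andP[ad bd]] no.
have mW x y z : all (mem [:: a; b; c; d]) [:: x; y; z] -> ~ p4 v x y z.
  by move/no => /andP[/negP].
have mW' x y z : all (mem [:: a; b; c; d]) [:: x; y; z] -> ~ p4 x v y z.
  by move/no => /andP[_ /negP].
rewrite /p4_type; case va: (adj v a); case vb: (adj v b); case vc: (adj v c); case vd: (adj v d);
  split => //; exfalso.
all: first [ try_p4 mW a b c | try_p4 mW b c d | try_p4 mW c b a | try_p4 mW d c b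
  | try_p4 mW' a c d | try_p4 mW' d b a | try_p4 mW' a d c | try_p4 mW' d a b ].
Qed.

Lemma sparse_p4 (H : sgraph) (a b c d v x y z t : H) :
  P4_sparse H -> p4 a b c d -> v \notin [:: a; b; c; d] ->
  p4 x y z t -> v \in [:: x; y; z; t] ->
  all (mem [:: v; a; b; c; d]) [:: x; y; z; t] -> False.
Proof.
move=> sp h vW h' vW' /allP sub.
have card5 : #|[set w in [:: v; a; b; c; d]]| = 5.
  by rewrite cardsE; apply/card_uniqP; rewrite cons_uniq vW p4_uniq.
have eW : [set w in [:: a; b; c; d]] = [set w in [:: x; y; z; t]].
  apply: (sp _ card5); [| |exact: p4_induces|exact: p4_induces].
  - by apply/subsetP=> w; rewrite !inE => ->; rewrite orbT.
  - by apply/subsetP=> w; rewrite inE => /sub; rewrite inE.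
have : v \in [set w in [:: a; b; c; d]] by rewrite eW inE.
by rewrite inE (negPf vW).
Qed.

Lemma sparse_type (H : sgraph) (a b c d v : H) :
  P4_sparse H -> p4 a b c d -> v \notin [:: a; b; c; d] -> p4_type a b c d v.
Proof.
move=> sp h vW; apply: p4_typeP => // x y z /and4P[xW yW zW _].
by rewrite -negb_or; apply/negP => /orP[] h';
  apply: (sparse_p4 sp h vW h'); rewrite /= !inE ?eqxx ?orbT //;
  move: xW yW zW; rewrite /= !inE => -> -> ->; rewrite !orbT.
Qed.

Definition p4_closed (H : sgraph) (D : seq H) : Prop :=
  forall x y z t, p4 x y z t ->
  has (mem D) [:: x; y; z; t] -> all (mem D) [:: x; y; z; t].

Lemma closed_type (H : sgraph) (D : seq H) (a b c d v : H) :
  p4_closed D -> all (mem D) [:: a; b; c; d] -> v \notin D ->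
  p4 a b c d -> p4_type a b c d v.
Proof.
move=> cl /allP WD vD h; apply: p4_typeP => // x y z /and4P[/WD xD yW zW _].
have nc p q r s : x \in [:: p; q; r; s] -> v \in [:: p; q; r; s] -> ~~ p4 p q r s.
  move=> xin vin; apply: contra vD => /cl h'.
  by apply: (allP (h' _)) => //; apply/hasP; exists x.
by apply/andP; split; apply: nc; rewrite !inE eqxx ?orbT.
Qed.

(** A vertex outside abcd on a P_4 meeting abcd is a partner, so there is at most one, u. A P_4
    meeting the five vertices in u alone is controlled by the partner condition of the P_4 that made
    u a partner. The last clause places u on a P_4 with three of a, b, c, d. *)
Lemma extendible_closed (H : sgraph) (a b c d : H) :
  P4_extendible H -> p4 a b c d ->
  exists2 u, p4_closed [:: u; a; b; c; d] &
    u \in [:: a; b; c; d] \/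
    exists x y z, all (mem [:: a; b; c; d]) [:: x; y; z] /\ (p4 u x y z \/ p4 x u y z).
Proof.
move=> ext h; pose W := [:: a; b; c; d].
have partner (p q r s x y z t v : H) : p4 p q r s -> p4 x y z t ->
    v \notin [:: p; q; r; s] -> has (mem [:: p; q; r; s]) [:: x; y; z; t] ->
    v \in [:: x; y; z; t] -> P4_partner [set w in [:: p; q; r; s]] v.
  move=> h1 h2 vW1 mt vW2; split; first by rewrite inE.
  exists [set w in [:: x; y; z; t]]; split; [exact: p4_induces| |by rewrite inE].
  by have /hasP[w w1 w2] := mt; apply/set0Pn; exists w; rewrite in_setI !in_set w1.
have [/existsP[u /existsP[x /existsP[y /existsP[z /existsP[t]]]]]|none] :=
  boolP [exists u, exists x, exists y, exists z, exists t,
    [&& p4 x y z t, u \notin W, has (mem W) [:: x; y; z; t] & u \in [:: x; y; z; t]]];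
  last first.
  (* Without a partner the path itself is closed, and a is a dummy value for u. *)
  exists a; last by left; rewrite inE eqxx.
  move=> x y z t h' mt; apply/allP=> v vin; apply: contraR none => vW.
  apply/existsP; exists v; apply/existsP; exists x; apply/existsP; exists y.
  apply/existsP; exists z; apply/existsP; exists t; apply/and4P; split=> //.
  - by apply: contra vW => vW; rewrite inE; apply/orP; right.
  - case/hasP: mt => w w1 w2; apply/hasP; exists w => //.
    by move: w2; rewrite inE => /predU1P[->|//]; exact: mem_head.
move=> /and4P[h' uW mt uW'].
have inD x' y' z' t' : p4 x' y' z' t' -> has (mem W) [:: x'; y'; z'; t'] ->
    all (mem (u :: W)) [:: x'; y'; z'; t'].
  move=> h1 m1; apply/allP=> v vin; change (v \in u :: W); rewrite in_cons.
  have [|vW] := boolP (v \in W).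
    by rewrite orbT.
  rewrite orbF; apply/eqP; apply: (ext _ (p4_induces h)).
    exact: partner h h1 vW m1 vin.
  exact: partner h h' uW mt uW'.
have W'D := inD _ _ _ _ h' mt.
(* W and u make five vertices, so the second P_4 omits some w of W. This w is the one partner of
   that P_4, hence any P_4 through u stays inside [u :: W]. *)
have [w wW wW'] : exists2 w, w \in W & w \notin [:: x; y; z; t].
  apply/hasP; apply: contraT => /hasPn sub.
  have : size (u :: W) <= size [:: x; y; z; t].
    apply: uniq_leq_size; first by rewrite cons_uniq uW p4_uniq.
    move=> v; rewrite inE => /predU1P[->//|/sub]; by rewrite negbK.
  by [].
exists u.
- move=> x' y' z' t' h1 m1.
  have [mW|mW] := boolP (has (mem W) [:: x'; y'; z'; t']); first exact: inD.
  have uin : u \in [:: x'; y'; z'; t'].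
    case/hasP: m1 => v v1; rewrite inE => /predU1P[<-//|v2].
    by case/negP: mW; apply/hasP; exists v.
  apply/allP=> v vin; have [v2|v2] := boolP (v \in [:: x; y; z; t]).
    exact: (allP W'D).
  have -> : v = w; last by change (w \in u :: W); rewrite in_cons wW orbT.
  apply: (ext _ (p4_induces h')).
    by apply: (partner _ _ _ _ _ _ _ _ _ h' h1 v2 _ vin); apply/hasP; exists u.
  apply: (partner _ _ _ _ _ _ _ _ _ h' h wW' _ wW).
  by case/hasP: mt => s s1 s2; apply/hasP; exists s.
- right.
  have inW v : v \in [:: x; y; z; t] -> v != u -> v \in W.
    by move=> /(allP W'D); rewrite inE => /predU1P[->|//]; rewrite eqxx.
  have := p4_uniq h'; rewrite /= !inE !negb_or andbT.
  case/and3P=> /and3P[xy xz xt] /andP[yz yt] zt.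
  have rev p q r s : p4 p q r s -> p4 s r q p.
    by move=> /and5P[? ? ? ? /andP[? ?]]; rewrite /p4; facts.
  move: uW'; rewrite !inE => /or4P[] /eqP eu; rewrite {u}eu in uW W'D inW inD *.
  + exists y, z, t; split; last by left.
    by rewrite /= !inW ?inE ?eqxx ?orbT // eq_sym.
  + exists x, z, t; split; last by right.
    by rewrite /= !inW ?inE ?eqxx ?orbT // eq_sym.
  + exists t, y, x; split; last by right; apply: rev.
    by rewrite /= !inW ?inE ?eqxx ?orbT // eq_sym.
  + exists z, y, x; split; last by left; apply: rev.
    by rewrite /= !inW ?inE ?eqxx ?orbT // eq_sym.
Qed.

(** * Connected minimal graphs *)

Definition connected (H : sgraph) : Prop := forall X : {set H}, ~ separates X.

(** That is, the complement is connected. *)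
Definition joinless (H : sgraph) : Prop :=
  forall X : {set H}, X != set0 -> ~: X != set0 -> ~ {in X & ~: X, forall x y, adj x y}.

Lemma independentU (H : sgraph) (I J : {set H}) :
  independent I -> independent J -> {in I & J, forall x y, ~~ adj x y} ->
  independent (I :|: J).
Proof.
move=> iI iJ IJ x y; rewrite !inE => /orP[] xI /orP[] yI.
- exact: iI.
- exact: IJ.
- by rewrite adj_sym IJ.
- exact: iJ.
Qed.

Lemma cliqueU (H : sgraph) (K L : {set H}) :
  clique K -> clique L -> {in K & L, forall x y, x != y -> adj x y} -> clique (K :|: L).
Proof.
move=> cK cL KL x y; rewrite !inE => /orP[] xK /orP[] yK xy.
- exact: cK.
- exact: KL.
- by rewrite adj_sym KL // eq_sym.
- exact: cL.
Qed.

Lemma independentS (H : sgraph) (I J : {set H}) :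
  I \subset J -> independent J -> independent I.
Proof. by move=> /subsetP IJ iJ x y /IJ xJ /IJ yJ; apply: iJ. Qed.

(** Were [S] all of H, [X] would separate H; so [S] is proper and minimality applies. *)
Lemma connected_part_polar (H : sgraph) (X S : {set H}) :
  minimal_nonpolar H -> connected H -> X \subset S -> X != set0 -> S :\: X != set0 ->
  {in X & S :\: X, forall x y, ~~ adj x y} -> polar S.
Proof.
move=> [_ mH] cn XS X0 Y0 XY; apply: mH; rewrite properT; apply/eqP => ST.
rewrite {}ST setTD in Y0 XY; apply: (cn X); split=> // x y xy.
have [xX|xX] := boolP (x \in X); have [yX|yX] := boolP (y \in X) => //.
  by have := XY x y xX; rewrite inE yX xy => /(_ isT).
by have := XY y x yX; rewrite inE xX adj_sym xy => /(_ isT).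
Qed.

(** If n were in [K], the whole P_4 would be in [M], where d misses the edge ab. So n is in [M], and
    so is a or d, which cannot both be in [K]. As [M] now meets both sides of an edgeless cut, any
    edge of it inside [S] is missed by one of these vertices: there is none. *)
Lemma p4_part_split (H : sgraph) (X S : {set H}) (n a b c d : H) :
  polar S -> p4 a b c d -> n \in X -> X \subset S ->
  {subset [:: a; b; c; d] <= S :\: X} ->
  {in X & S :\: X, forall x y, ~~ adj x y} -> is_split S.
Proof.
move=> [K [M [/subsetP cov cK mM]]] h nX XS WS XY.
have WSX w : w \in [:: a; b; c; d] -> w \in S by move/WS; rewrite inE => /andP[].
have nW w : w \in S :\: X -> n != w.
  by move=> wS; apply: contraTneq wS => <-; rewrite inE nX.
have nS : n \in S by apply: (subsetP XS).
have [ad nad] : ~~ adj a d /\ a != d.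
  have := p4_uniq h; rewrite /= !inE !negb_or => /and4P[/and3P[_ _ ->] _ _ _].
  by case/and5P: h => _ _ _ _ /andP[].
have [aW bW dW] : [/\ a \in S :\: X, b \in S :\: X & d \in S :\: X].
  by split; apply: WS; rewrite !inE eqxx ?orbT.
have inKM w : w \in S -> w \notin K -> w \in M.
  by move=> /cov; rewrite inE => /orP[->|].
have inS w : w \in S :\: X -> w \in S by rewrite inE => /andP[].
have nK : n \notin K.
  apply/negP => nK; have wM w : w \in S :\: X -> w \in M.
    move=> wS; apply: inKM (inS _ wS) _; apply/negP => wK.
    by have := cK _ _ nK wK (nW _ wS); rewrite (negPf (XY _ _ nX wS)).
  have /and5P[ab _ _ _ /andP[_ bd]] := h.
  by have := mM _ _ _ (wM _ aW) (wM _ bW) (wM _ dW) ab; rewrite (negPf ad) (negPf bd).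
have nM := inKM _ nS nK.
have [w wS wM] : exists2 w, w \in S :\: X & w \in M.
  have [aK|aK] := boolP (a \in K); last by exists a; rewrite ?inKM ?inS.
  exists d => //; apply: inKM (inS _ dW) _; apply/negP => dK.
  by rewrite cK in ad.
exists K, (M :&: S); split=> //.
  by apply/subsetP=> v vS; have := cov v vS; rewrite !inE vS andbT.
have stay p q : p \in X -> q \in S -> adj p q -> q \in X.
  move=> pX qS pq; apply: contraT => qX.
  by have := XY p q pX; rewrite inE qX qS pq => /(_ isT).
move=> p q; rewrite !inE => /andP[pM pS] /andP[qM qS]; apply/negP => pq.
have [pX qX] : p \in X /\ q \in X.
  have /orP[] := mM _ _ _ pM qM nM pq; rewrite adj_sym => /stay hX.
    by have pX := hX nX pS; split=> //; apply: stay pX qS pq.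
  have qX := hX nX qS; split=> //; apply: (stay q) => //.
  by rewrite adj_sym.
by have := mM _ _ _ pM qM wM pq; rewrite (negPf (XY _ _ pX wS)) (negPf (XY _ _ qX wS)).
Qed.

Lemma connected_p4_split (H : sgraph) (X S : {set H}) (n a b c d : H) :
  minimal_nonpolar H -> connected H -> p4 a b c d -> n \in X -> X \subset S ->
  {subset [:: a; b; c; d] <= S :\: X} ->
  {in X & S :\: X, forall x y, ~~ adj x y} -> is_split S.
Proof.
move=> mH cn h nX XS WS XY; apply: (p4_part_split _ h nX XS WS XY).
apply: connected_part_polar XS _ _ XY => //.
  by apply/set0Pn; exists n.
by apply/set0Pn; exists a; apply: WS; rewrite inE eqxx.
Qed.

(** In a split cover of N with the path, a vertex of N in the clique would push the whole path into
    the independent set, despite the edge ab. *)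
Lemma anticomplete_p4_independent (H : sgraph) (N : {set H}) (a b c d : H) :
  minimal_nonpolar H -> connected H -> p4 a b c d ->
  {in N, forall n, n \notin [:: a; b; c; d] /\
    {in [:: a; b; c; d], forall w, ~~ adj n w}} ->
  independent N.
Proof.
move=> mH cn h NW x y xN yN; apply/negP => xy.
pose S := N :|: [set w in [:: a; b; c; d]].
have WN w : w \in [:: a; b; c; d] -> w \in S :\: N.
  move=> wW; rewrite in_setD in_setU in_set wW orbT andbT.
  by apply: contraL wW => /NW[].
have [|K [I [/subsetP cov cK iI]]] :=
  @connected_p4_split H N S x a b c d mH cn h xN (subsetUl _ _) WN.
  move=> n w nN; rewrite in_setD in_setU in_set => /andP[/negPf->] /= wW.
  by have [_] := NW n nN; apply.
have noK n : n \in N -> n \in S -> n \notin K.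
  move=> nN nS; apply/negP => nK; have [nW na] := NW n nN.
  have wI w : w \in [:: a; b; c; d] -> w \in I.
    move=> wW; have := cov w; rewrite !in_setU [w \in [set _ in _]]in_set wW orbT.
    move=> /(_ isT)/orP[wK|//].
    have : adj n w by apply: cK => //; apply: contraNneq nW => ->.
    by rewrite (negPf (na w wW)).
  have := iI a b; rewrite !wI ?inE ?eqxx ?orbT // => /(_ isT isT).
  by case/andP: h => ->.
have inI n : n \in N -> n \in I.
  move=> nN; have nS : n \in S by rewrite inE nN.
  by have := cov n nS; rewrite inE (negPf (noK n nN nS)).
by have := iI x y (inI _ xN) (inI _ yN); rewrite xy.
Qed.

(** The set R+a+d omits b, so it is proper and polar. An edge of R inside [M] is missed by a and d,
    which would both be forced into [K] although they are non-adjacent. *)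
Lemma head_split (H : sgraph) (R : {set H}) (a b d : H) :
  minimal_nonpolar H -> a != d -> ~~ adj a d -> a != b -> d != b -> b \notin R ->
  {in R, forall r, ~~ adj r a && ~~ adj r d} -> is_split R.
Proof.
move=> [_ mH] nad ad nab ndb bR RW.
have [|K [M [/subsetP cov cK mM]]] := mH (a |: (d |: R)).
  rewrite properT; apply/eqP => /setP/(_ b).
  by rewrite !inE eq_sym (negPf nab) eq_sym (negPf ndb) (negPf bR).
exists K, (M :&: R); split=> //.
  apply/subsetP=> r rR; have := cov r; rewrite !inE rR !orbT andbT.
  exact.
move=> p q; rewrite !inE => /andP[pM pR] /andP[qM qR]; apply/negP => pq.
have /andP[pa pd] := RW p pR; have /andP[qa qd] := RW q qR.
have [aK dK] : a \in K /\ d \in K.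
  split; [have := cov a | have := cov d]; rewrite !inE eqxx ?orbT => /(_ isT).
    by case/orP=> // aM; have := mM _ _ _ pM qM aM pq; rewrite (negPf pa) (negPf qa).
  by case/orP=> // dM; have := mM _ _ _ pM qM dM pq; rewrite (negPf pd) (negPf qd).
by rewrite cK in ad.
Qed.

(* Vertices of A with a non-neighbour in A would be completely joined to the rest. *)
Lemma joinless_clique (H : sgraph) (A : {set H}) :
  joinless H -> A != setT ->
  (forall x y v, x \in A -> y \in A -> x != y -> ~~ adj x y -> v \notin A -> adj v x) ->
  clique A.
Proof.
move=> jl AT out; pose T := [set x in A | [exists y in A, (x != y) && ~~ adj x y]].
move=> x y xA yA xy; apply: contraT => nxy.
have xT : x \in T.
  by rewrite inE xA; apply/exists_inP; exists y; rewrite // xy.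
exfalso; apply: (jl T); first by apply/set0Pn; exists x.
  apply: contra AT => /eqP e; rewrite -subTset; apply/subsetP=> u _.
  have : u \in T by have := in_set0 u; rewrite -e in_setC => /negbT; rewrite negbK.
  by rewrite inE => /andP[].
move=> t v tT; rewrite in_setC => vT.
have tv : v != t by apply: contraNneq vT => ->.
have := tT; rewrite inE => /andP[tA /exists_inP[s sA /andP[ts nts]]].
rewrite adj_sym; have [vA|vA] := boolP (v \in A); last exact: out ts nts vA.
apply: contraR vT => nvt; rewrite inE vA; apply/exists_inP; exists t => //.
by rewrite tv.
Qed.

(** [no1] and [no2] isolate what the two classes justify differently. Let x, y in A be non-adjacent
    and v miss x: if v sees y but not a, v y a x is a P_4; if v misses both and sees c but not a,
    both a x c v and a y c v are. *)
Lemma p4_clique (H : sgraph) (A : {set H}) (a b c d : H) :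
  minimal_nonpolar H -> connected H -> joinless H -> p4 a b c d ->
  {in A, forall x, x \notin [:: a; b; c; d] /\ {in [:: a; b; c; d], forall w, adj x w}} ->
  (forall v, v \notin A ->
    [\/ {in A, forall x, adj v x},
        v \notin [:: a; b; c; d] /\ {in [:: a; b; c; d], forall w, ~~ adj v w}
      | adj v c && ~~ adj v a]) ->
  (forall x y v, x \in A -> y \in A -> v \notin A -> x != y -> ~~ p4 v y a x) ->
  (forall x y v, x \in A -> y \in A -> v \notin A -> x != y ->
     p4 a x c v -> ~~ p4 a y c v) ->
  clique A.
Proof.
move=> mH cn jl h AW types no1 no2; apply: joinless_clique => //.
  apply/eqP => AT; have := in_setT a; rewrite -AT => /AW[].
  by rewrite inE eqxx.
move=> x y v xA yA nxy xy vA; apply: contraT => vx.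
have [_ xW] := AW x xA; have [_ yW] := AW y yA.
have [aW cW dW] : [/\ a \in [:: a; b; c; d], c \in [:: a; b; c; d] & d \in [:: a; b; c; d]].
  by rewrite !inE !eqxx ?orbT.
have [xa xc xd] : [/\ adj x a, adj x c & adj x d] by split; apply: xW.
have [ya yc yd] : [/\ adj y a, adj y c & adj y d] by split; apply: yW.
have [ac ad] : ~~ adj a c /\ ~~ adj a d by case/and5P: h => _ _ _ -> /andP[->].
have nad : a != d.
  by have := p4_uniq h; rewrite /= !inE !negb_or => /and4P[/and3P[_ _ ->]].
have va_no : ~~ adj v a -> adj v y -> False.
  by move=> va vy; have := no1 x y v xA yA vA nxy; rewrite /p4; facts.
case: (types v vA) => [vT|[vW va]|/andP[vc va]].
- by rewrite vT in vx.
- have [vy|vy] := boolP (adj v y); first by case: (va_no _ vy); apply: va.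
  (* Here v misses the path, x and y, so [S] is split. The independent part contains neither x nor
     y, as a and d would then both be in the clique; so x and y are adjacent. *)
  pose S := v |: (x |: (y |: [set w in [:: a; b; c; d]])).
  have xv : x != v by apply: contraNneq vA => <-.
  have yv : y != v by apply: contraNneq vA => <-.
  have WS : {subset [:: a; b; c; d] <= S :\: [set v]}.
    move=> w wW; rewrite in_setD !in_setU !in_set1 in_set wW !orbT andbT.
    by apply: contraNneq vW => <-.
  have [|K [I [/subsetP cov cK iI]]] :=
    @connected_p4_split H [set v] S v a b c d mH cn h (set11 v) (subsetUl _ _) WS.
    move=> u w; rewrite in_setD !in_setU !in_set1 [w \in [set _ in _]]in_set => /eqP->.
    by case/andP=> /negPf-> /= /or3P[/eqP->|/eqP->|/va].
  have inS w : w \in [:: a; b; c; d] -> w \in S.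
    by move/WS; rewrite in_setD => /andP[].
  have hI z : z \in S -> adj z a -> adj z d -> z \notin I.
    move=> zS za zd; apply/negP => zI.
    have inK w : w \in [:: a; b; c; d] -> adj z w -> w \in K.
      move=> wW zw; have := cov w (inS w wW); rewrite inE => /orP[//|wI].
      by have := iI z w zI wI; rewrite zw.
    by have := cK a d (inK a aW za) (inK d dW zd) nad; rewrite (negPf ad).
  have xS : x \in S by rewrite !inE eqxx orbT.
  have yS : y \in S by rewrite !inE eqxx !orbT.
  have xK : x \in K by have := cov x xS; rewrite inE (negPf (hI x xS xa xd)) orbF.
  have yK : y \in K by have := cov y yS; rewrite inE (negPf (hI y yS ya yd)) orbF.
  by have := cK x y xK yK nxy; rewrite (negPf xy).
- have [vy|vy] := boolP (adj v y); first by case: (va_no va vy).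
  have p1 : p4 a x c v by rewrite /p4; facts.
  by have := no2 x y v xA yA vA nxy p1; rewrite /p4; facts.
Qed.

(** * The P4-sparse case *)

(** The split partition of R is corrected: vertices of R seen from N ([RN]) move to the clique,
    those missed by a vertex of A ([RA]) to the independent set. The former are complete to A and to
    the rest of R, the latter anticomplete to the rest of R. *)
Lemma sparse_split (H : sgraph) (a b c d : H) :
  P4_sparse H -> minimal_nonpolar H -> connected H -> joinless H ->
  p4 a b c d -> is_split [set: H].
Proof.
move=> sp mH cn jl h; pose W := [:: a; b; c; d].
have un := p4_uniq h; have := un; rewrite /= !inE !negb_or andbT.
case/and3P=> /and3P[nab nac nad] /andP[nbc nbd] ncd.
have /and5P[ab bc cd ac /andP[ad bd]] := h.
have ty v : v \notin W -> p4_type a b c d v by apply: sparse_type.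
pose N := [set v | (v \notin W) && ~~ adj v b].
pose A := [set v | (v \notin W) && adj v a].
pose R := [set v | (v \notin W) && (adj v b && ~~ adj v a)].
have NP n : n \in N -> n \notin W /\ [/\ ~~ adj n a, ~~ adj n b, ~~ adj n c & ~~ adj n d].
  rewrite inE => /andP[nW nb]; split=> //; have [<- <- ab'] := ty n nW.
  by split=> //; apply: contra nb.
have AP x : x \in A -> x \notin W /\ [/\ adj x a, adj x b, adj x c & adj x d].
  rewrite inE => /andP[xW xa]; split=> //; have [<- <- ab'] := ty x xW.
  by split=> //; apply: ab'.
have RP r : r \in R -> r \notin W /\ [/\ ~~ adj r a, adj r b, adj r c & ~~ adj r d].
  by rewrite inE => /and3P[rW rb ra]; split=> //; have [<- <- _] := ty r rW.
have cover v : v \notin W -> [|| v \in N, v \in A | v \in R].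
  by rewrite !inE => -> /=; case: (adj v a); case: (adj v b).
(* The type of s with respect to the path n r b a: s sees r as it sees b, and n as it sees a. *)
have nR n r s : n \in N -> r \in R -> s \in R -> adj n r -> s != r ->
    adj s r /\ ~~ adj s n.
  move=> nN rR sR nr sr.
  have [nW [na nb _ _]] := NP n nN; have [rW [ra rb _ _]] := RP r rR.
  have [sW [sa sb _ _]] := RP s sR.
  have h' : p4 n r b a by rewrite /p4; facts.
  have sn : s != n by apply: contraNneq nb => <-.
  have sW' : s \notin [:: n; r; b; a].
    by move: sW; rewrite !inE !negb_or => /and4P[-> -> _ _]; rewrite sn sr.
  have [-> -> _] := sparse_type sp h' sW'.
  by rewrite sb sa.
(* The type of s with respect to the path a x c r: s sees r as it sees a. *)
have xR x r s : x \in A -> r \in R -> s \in R -> ~~ adj x r -> s != r -> ~~ adj s r.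
  move=> xA rR sR xr sr.
  have [xW [xa xb xc xd]] := AP x xA; have [rW [ra rb rc _]] := RP r rR.
  have [sW [sa _ _ _]] := RP s sR.
  have h' : p4 a x c r by rewrite /p4; facts.
  have sx : s != x by apply: contraNneq sa => ->.
  have sW' : s \notin [:: a; x; c; r].
    by move: sW; rewrite !inE !negb_or => /and4P[-> _ -> _]; rewrite sx sr.
  by have [<- _ _] := sparse_type sp h' sW'.
have xnr x n r : x \in A -> n \in N -> r \in R -> adj n r -> adj x r.
  move=> xA nN rR nr.
  have [xW [xa xb xc xd]] := AP x xA; have [rW [ra rb rc _]] := RP r rR.
  have [nW [na nb _ _]] := NP n nN.
  have h' : p4 n r b a by rewrite /p4; facts.
  have xn : x != n by apply: contraTneq xa => ->.
  have nxr : x != r by apply: contraTneq xa => ->.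
  have xW' : x \notin [:: n; r; b; a].
    by move: xW; rewrite !inE !negb_or => /and4P[-> -> _ _]; rewrite xn nxr.
  by have [_ -> _] := sparse_type sp h' xW'.
have iN : independent N.
  apply: (anticomplete_p4_independent mH cn h) => n /NP[nW [na nb nc nd]].
  by split=> // w; rewrite !inE => /or4P[] /eqP->.
have [KR [IR [/subsetP covR cKR iIR]]] : is_split R.
  apply: (head_split mH nad ad nab); rewrite 1?eq_sym //.
    by apply/negP => /RP[]; rewrite !inE eqxx orbT.
  by move=> r /RP[_ [-> _ _ ->]].
have cA : clique A.
  apply: (p4_clique mH cn jl h).
  - by move=> x /AP[xW [xa xb xc xd]]; split=> // w; rewrite !inE => /or4P[] /eqP->.
  - move=> v vA; have [vW|vW] := boolP (v \in W).
      apply: Or31 => x /AP[_ [xa xb xc xd]]; rewrite adj_sym.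
      by move: vW; rewrite !inE => /or4P[] /eqP->.
    have := cover v vW; rewrite (negPf vA) /= => /orP[/NP|/RP] [_ [va vb vc vd]].
      by apply: Or32; split=> // w; rewrite !inE => /or4P[] /eqP->.
    by apply: Or33; rewrite vc.
  - move=> x y v xA yA vA xy; apply/negP => h'.
    have [[xW [xa xb xc xd]] [yW [ya yb yc yd]]] := (AP x xA, AP y yA).
    have vx : ~~ adj v x by case/and5P: h' => _ _ _ _ /andP[].
    have vW : v \notin W.
      by rewrite !inE; apply: contra vx => /or4P[] /eqP->; rewrite adj_sym.
    have dW : d \notin [:: v; y; a; x].
      move: xW yW vW; rewrite !inE !negb_or => /and4P[_ _ _ xd'] /and4P[_ _ _ yd'].
      by case/and4P=> _ _ _ vd'; rewrite ![d == _]eq_sym vd' yd' nad xd'.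
    have [dv _ _] := sparse_type sp h' dW.
    have [va _ _] := ty v vW.
    by move: vA; rewrite inE vW va adj_sym dv adj_sym xd.
  - move=> x y v xA yA vA xy h'; apply/negP => h2.
    have [[xW [xa xb xc xd]] [yW [ya yb yc yd]]] := (AP x xA, AP y yA).
    have yW' : y \notin [:: a; x; c; v].
      move: yW; rewrite !inE !negb_or => /and4P[-> _ -> _]; rewrite eq_sym xy.
      by apply: contraNneq vA => <-.
    have [yv _ _] := sparse_type sp h' yW'.
    by have /and5P[_ _ _ _ /andP[_]] := h2; rewrite -yv ya.
pose RN := [set r in R | [exists n in N, adj n r]].
pose RA := [set r in R | [exists x in A, ~~ adj x r]].
have RN_RA r : r \in RN -> r \notin RA.
  rewrite in_set => /andP[rR /exists_inP[n nN nr]]; rewrite in_set rR /=.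
  by apply/exists_inPn => x xA; rewrite negbK; apply: xnr xA nN rR nr.
have subR (P : pred H) : {subset [set r in R | P r] <= R}.
  by move=> r; rewrite in_set => /andP[].
exists ([set b; c] :|: (A :|: (RN :|: (KR :&: R) :\: RA))).
exists ([set a; d] :|: (N :|: (RA :|: (IR :&: R) :\: RN))); split.
- apply/subsetP=> v _; rewrite !in_setU.
  have [vW|vW] := boolP (v \in W).
    by move: vW; rewrite !inE => /or4P[] ->; rewrite ?orbT.
  have /or3P[->|->|vR] := cover v vW; rewrite ?orbT //.
  have [vN|vN] := boolP (v \in RN); first by rewrite !orbT.
  have [vA|vA] := boolP (v \in RA); first by rewrite !orbT.
  rewrite !in_setD !in_setI vR vA vN /= !andbT.
  by have := covR v vR; rewrite in_setU => /orP[] ->; rewrite !orbT.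
- have RN_clique r s : r \in RN -> s \in R -> r != s -> adj r s.
    rewrite in_set => /andP[rR /exists_inP[n nN nr]] sR rs.
    by rewrite eq_sym in rs; rewrite adj_sym; have [] := nR n r s nN rR sR nr rs.
  apply: cliqueU; [|apply: cliqueU => //; [apply: cliqueU|]|].
  + by move=> x y; rewrite !inE => /orP[] /eqP-> /orP[] /eqP->;
      rewrite ?eqxx // adj_sym.
  + by move=> r s rRN /subR; apply: RN_clique.
  + by apply: cliqueS cKR; apply/subsetP=> r; rewrite in_setD in_setI => /and3P[].
  + by move=> r s rRN; rewrite in_setD in_setI => /and3P[_ _ sR]; apply: RN_clique.
  + move=> x r xA; rewrite in_setU => /orP[|].
      by rewrite in_set => /andP[rR /exists_inP[n nN nr]] _; apply: xnr xA nN rR nr.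
    rewrite in_setD in_setI => /and3P[rRA _ rR] _; apply: contraR rRA => xr.
    by rewrite in_set rR; apply/exists_inP; exists x.
  + move=> u v uW; rewrite !in_setU in_setD in_setI => vT _.
    suff [vb vc] : adj v b /\ adj v c.
      by move: uW; rewrite !inE => /orP[] /eqP->; rewrite adj_sym.
    have : (v \in A) || (v \in R).
      by case/or3P: vT => [->//|/subR->|/and3P[_ _ ->]]; rewrite orbT.
    by case/orP=> [/AP|/RP] [_ []].
- have RA_indep r s : r \in RA -> s \in R -> ~~ adj r s.
    rewrite in_set => /andP[rR /exists_inP[x xA xr]] sR.
    have [->|sr] := eqVneq s r; first by rewrite adj_irr.
    by rewrite adj_sym; apply: xR xA rR sR xr sr.
  have N_indep n r : n \in N -> r \in R -> r \notin RN -> ~~ adj n r.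
    move=> nN rR; apply: contra => nr; rewrite in_set rR.
    by apply/exists_inP; exists n.
  apply: independentU; [|apply: independentU => //; [apply: independentU|]|].
  + by move=> x y; rewrite !inE => /orP[] /eqP-> /orP[] /eqP->;
      rewrite ?adj_irr // adj_sym.
  + by move=> r s rRA /subR; apply: RA_indep.
  + by apply: independentS iIR; apply/subsetP=> r; rewrite in_setD in_setI => /and3P[].
  + by move=> r s rRA; rewrite in_setD in_setI => /and3P[_ _ sR]; apply: RA_indep.
  + move=> n r nN; rewrite in_setU => /orP[rRA|].
      apply: N_indep; [by []|exact: subR rRA|].
      by apply: contraL rRA; apply: RN_RA.
    by rewrite in_setD in_setI => /and3P[? _ ?]; apply: N_indep.
  + move=> u v uW; rewrite !in_setU in_setD in_setI => vT.
    suff [va vd] : ~~ adj v a /\ ~~ adj v d.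
      by move: uW; rewrite !inE => /orP[] /eqP->; rewrite adj_sym.
    have : (v \in N) || (v \in R).
      by case/or3P: vT => [->//|/subR->|/and3P[_ _ ->]]; rewrite orbT.
    by case/orP=> [/NP|/RP] [_ []].
Qed.

(** * The P4-extendible case *)

Lemma biclique_multipartite (H : sgraph) (P Q : {set H}) :
  independent P -> independent Q -> {in P & Q, forall x y, adj x y} ->
  multipartite (P :|: Q).
Proof.
move=> iP iQ PQ x y z; rewrite !in_setU => /orP[] xP /orP[] yQ zPQ xy.
- by rewrite (negPf (iP _ _ xP yQ)) in xy.
- case/orP: zPQ => zP; first by rewrite [adj y z]adj_sym (PQ z) ?orbT.
  by rewrite (PQ x z).
- case/orP: zPQ => zP; first by rewrite [adj x z]adj_sym (PQ z).
  by rewrite (PQ y z) ?orbT.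
- by rewrite (negPf (iQ _ _ xP yQ)) in xy.
Qed.

Lemma independent2 (H : sgraph) (x y : H) : ~~ adj x y -> independent [set x; y].
Proof.
move=> xy u v; rewrite !inE => /orP[] /eqP-> /orP[] /eqP->;
  by rewrite ?adj_irr // adj_sym.
Qed.

Lemma independentU1 (H : sgraph) (I : {set H}) (x : H) :
  independent I -> {in I, forall y, ~~ adj x y} -> independent (x |: I).
Proof.
move=> iI xI; apply: independentU => // [u v|u v].
  by rewrite !inE => /eqP-> /eqP->; rewrite adj_irr.
by rewrite inE => /eqP->; apply: xI.
Qed.

Lemma clique2 (H : sgraph) (x y : H) : adj x y -> clique [set x; y].
Proof.
move=> xy u v; rewrite !inE => /orP[] /eqP-> /orP[] /eqP->;
  by rewrite ?eqxx // adj_sym.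
Qed.

(* u is a non-adjacent twin of the midpoint b. *)
Lemma midpoint_twin_polar (H : sgraph) (R : {set H}) (a b c d u : H) :
  minimal_nonpolar H -> p4 a b c d ->
  adj u a -> ~~ adj u b -> adj u c -> ~~ adj u d -> u != b ->
  {in R, forall r, [/\ ~~ adj r a, adj r b, adj r c, ~~ adj r d & adj r u]} ->
  (forall v, v \in [:: u; a; b; c; d] \/ v \in R) ->
  polar [set: H].
Proof.
move=> [_ mH] h ua ub uc ud nub RW cov.
have un := p4_uniq h; have := un; rewrite /= !inE !negb_or andbT.
case/and3P=> /and3P[nab nac nad] /andP[nbc nbd] ncd.
have /and5P[ab bc cd ac /andP[ad bd]] := h.
have iR : independent R.
  move=> r s rR sR; apply/negP => rs.
  have [ra rb rc rd ru] := RW r rR; have [sa sb sc sd su] := RW s sR.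
  (* [S] omits c, so it is polar. If d is in [K], then a and the edge rs are in [M]. If d is in [M],
     no edge among the other vertices of [S] lies in [M], yet [M] takes one of b, u and one of a, r,
     which are adjacent. *)
  pose S := [set d; a; b; u] :|: R.
  have [|K [M [/subsetP cS cK mM]]] := mH S.
    rewrite properT; apply/eqP => /setP/(_ c).
    rewrite /S !inE; facts; rewrite /= => /RW[].
    by rewrite adj_irr.
  have [dS [aS [bS [uS rS]]]] :
      d \in S /\ a \in S /\ b \in S /\ u \in S /\ {subset R <= S}.
    rewrite /S !inE !eqxx ?orbT; do !split=> //.
    by move=> x xR; rewrite !inE xR orbT.
  have KM x : x \in S -> x \in K \/ x \in M.
    by move=> xS; have := cS x xS; rewrite inE => /orP.
  have nK x y : x \in K -> ~~ adj x y -> x != y -> y \in S -> y \in M.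
    move=> xK xy nxy yS; have [yK|//] := KM y yS.
    by rewrite (cK x y xK yK nxy) in xy.
  have [dK|dM] := KM d dS.
    have ? : d != r by distinct.
    have ? : d != s by distinct.
    have aM : a \in M by apply: (nK d); rewrite // ?[adj d a]adj_sym // eq_sym.
    have rM : r \in M by apply: (nK d); rewrite // 1?adj_sym // rS.
    have sM : s \in M by apply: (nK d); rewrite // 1?adj_sym // rS.
    by have := mM _ _ _ rM sM aM rs; rewrite (negPf ra) (negPf sa).
  have nM x y : x \in M -> y \in M -> ~~ adj x d -> ~~ adj y d -> adj x y -> False.
    by move=> xM yM xd yd xy; have := mM _ _ _ xM yM dM xy; rewrite (negPf xd) (negPf yd).
  have nar : a != r by distinct.
  have ar : ~~ adj a r by rewrite adj_sym.
  have [bM|uM] : b \in M \/ u \in M.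
    by have [uK|] := KM u uS; [left; apply: (nK u)|right].
    have [aM|rM] : a \in M \/ r \in M.
      by have [aK|] := KM a aS; [right; apply: (nK a) => //; apply: rS|left].
    exact: (nM a b).
    exact: (nM r b).
  have [aM|rM] : a \in M \/ r \in M.
    by have [aK|] := KM a aS; [right; apply: (nK a) => //; apply: rS|left].
  exact: (nM u a).
  exact: (nM r u).
exists [set c; d], ((a |: R) :|: [set b; u]); split.
- apply/subsetP=> v _; have [|vR] := cov v; last by rewrite !inE vR !orbT.
  by rewrite !inE => /or4P[|||/orP[]] ->; rewrite ?orbT.
- exact: clique2.
- apply: biclique_multipartite.
  + by apply: independentU1 => // r /RW[ra _ _ _ _]; rewrite adj_sym.
  + by apply: independent2; rewrite adj_sym.
  + move=> x y; rewrite !inE => /orP[/eqP->|/RW[_ rb _ _ ru]] /orP[] /eqP-> //.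
    by rewrite adj_sym.
Qed.

(* u is an adjacent twin of the endpoint a. *)
Lemma endpoint_twin_polar (H : sgraph) (R : {set H}) (a b c d u : H) :
  minimal_nonpolar H -> p4 a b c d ->
  adj u a -> adj u b -> ~~ adj u c -> ~~ adj u d ->
  {in R, forall r, [/\ ~~ adj r a, adj r b, adj r c, ~~ adj r d & ~~ adj r u]} ->
  (forall v, v \in [:: u; a; b; c; d] \/ v \in R) ->
  polar [set: H].
Proof.
move=> [_ mH] h ua ub uc ud RW cov.
have un := p4_uniq h; have := un; rewrite /= !inE !negb_or andbT.
case/and3P=> /and3P[nab nac nad] /andP[nbc nbd] ncd.
have /and5P[ab bc cd ac /andP[ad bd]] := h.
have iR : independent R.
  move=> r s rR sR; apply/negP => rs.
  have [ra rb rc rd ru] := RW r rR; have [sa sb sc sd su] := RW s sR.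
  (* [S] omits b, so it is polar. If d is in [K], then r and the edge ua, which it misses, are in
     [M]. If d is in [M], then neither ua nor rs can lie in [M], but a or u in [K] forces all of R
     into [M]. *)
  pose S := [set d; a; u] :|: R.
  have [|K [M [/subsetP cS cK mM]]] := mH S.
    rewrite properT; apply/eqP => /setP/(_ b).
    rewrite /S !inE; facts; rewrite /= => /RW[].
    by rewrite adj_irr.
  have [dS [aS [uS rS]]] : d \in S /\ a \in S /\ u \in S /\ {subset R <= S}.
    rewrite /S !inE !eqxx ?orbT; do !split=> //.
    by move=> x xR; rewrite !inE xR orbT.
  have KM x : x \in S -> x \in K \/ x \in M.
    by move=> xS; have := cS x xS; rewrite inE => /orP.
  have nK x y : x \in K -> ~~ adj x y -> x != y -> y \in S -> y \in M.
    move=> xK xy nxy yS; have [yK|//] := KM y yS.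
    by rewrite (cK x y xK yK nxy) in xy.
  have nud : u != d by distinct.
  have [dK|dM] := KM d dS.
    have ? : d != r by distinct.
    have aM : a \in M by apply: (nK d); rewrite // ?[adj d a]adj_sym // eq_sym.
    have uM : u \in M by apply: (nK d); rewrite // 1?adj_sym // eq_sym.
    have rM : r \in M by apply: (nK d); rewrite // 1?adj_sym // rS.
    have := mM _ _ _ uM aM rM ua.
    by rewrite [adj u r]adj_sym [adj a r]adj_sym (negPf ra) (negPf ru).
  have nM x y : x \in M -> y \in M -> ~~ adj x d -> ~~ adj y d -> adj x y -> False.
    by move=> xM yM xd yd xy; have := mM _ _ _ xM yM dM xy; rewrite (negPf xd) (negPf yd).
  have inM x : x \in [set a; u] -> x \in K -> False.
    move=> xau xK; have all_R t : t \in R -> t \in M.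
      move=> tR; have [ta tb _ _ tu] := RW t tR; apply: (nK x t xK _ _ (rS t tR)).
        by move: xau; rewrite !inE => /orP[] /eqP->; rewrite adj_sym.
      by move: xau; rewrite !inE => /orP[] /eqP->; distinct.
    exact: (nM r s (all_R r rR) (all_R s sR)).
  have [aK|aM] := KM a aS; first by apply: (inM a) => //; rewrite !inE eqxx.
  have [uK|uM] := KM u uS; first by apply: (inM u) => //; rewrite !inE eqxx orbT.
  exact: (nM u a).
exists (u |: [set a; b]), ([set c] :|: (d |: R)); split.
- apply/subsetP=> v _; have [|vR] := cov v; last by rewrite !inE vR !orbT.
  by rewrite !inE => /or4P[|||/orP[]] ->; rewrite ?orbT.
- apply: cliqueU1; first exact: clique2.
  by move=> k; rewrite !inE => /orP[] /eqP->.
- apply: biclique_multipartite.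
  + by move=> x y; rewrite !inE => /eqP-> /eqP->; rewrite adj_irr.
  + by apply: independentU1 => // r /RW[_ _ _ rd _]; rewrite adj_sym.
  + move=> x y; rewrite !inE => /eqP-> /orP[/eqP->//|/RW[_ _ rc _ _]].
    by rewrite adj_sym.
Qed.

Lemma p4_rev (H : sgraph) (a b c d : H) : p4 a b c d -> p4 d c b a.
Proof. by move=> /and5P[? ? ? ? /andP[? ?]]; rewrite /p4; facts. Qed.

(** Explicit covers, after reversing the path so that u sees a whenever it sees d. The vertex u may
    be one of the four, in which case the parts may overlap. *)
Lemma p4_plus_one_polar (H : sgraph) (a b c d u : H) :
  p4 a b c d -> (forall v, v \in [:: u; a; b; c; d]) -> polar [set: H].
Proof.
wlog uad : a b c d / adj u d -> adj u a.
  move=> hw h cov; have [ua|ua] := boolP (adj u a); first exact: (hw a b c d).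
  apply: (hw d c b a) => //; [by rewrite (negPf ua)|exact: p4_rev|].
  by move=> v; have := cov v; rewrite !inE => /or4P[|||/orP[]] ->; rewrite ?orbT.
move=> h cov; have /and5P[ab bc cd ac /andP[ad bd]] := h.
have cov2 (K M : {set H}) :
    {subset [:: u; a; b; c; d] <= K :|: M} -> [set: H] \subset K :|: M.
  by move=> s; apply/subsetP=> v _; apply: s.
have [ua|ua] := boolP (adj u a); last first.
  have ud : ~~ adj u d by apply: contra ua.
  exists [set b; c], [set a; d; u]; split.
  - by apply: cov2 => v; rewrite !inE => /or4P[|||/orP[]] ->; rewrite ?orbT.
  - exact: clique2.
  - move=> x y z; rewrite !inE => /orP[/orP[]|] /eqP-> /orP[/orP[]|] /eqP->;
    facts; by [].
have [ud|ud] := boolP (adj u d).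
  exists [set b; c], ([set a; d] :|: [set u]); split.
  - by apply: cov2 => v; rewrite !inE => /or4P[|||/orP[]] ->; rewrite ?orbT.
  - exact: clique2.
  - apply: biclique_multipartite; first exact: independent2.
      by move=> x y; rewrite !inE => /eqP-> /eqP->; rewrite adj_irr.
    by move=> x y; rewrite !inE => /orP[] /eqP-> /eqP->; rewrite adj_sym.
have [uc|uc] := boolP (adj u c).
  exists [set a; b], ([set d; u] :|: [set c]); split.
  - by apply: cov2 => v; rewrite !inE => /or4P[|||/orP[]] ->; rewrite ?orbT.
  - exact: clique2.
  - apply: biclique_multipartite; first by apply: independent2; rewrite adj_sym.
      by move=> x y; rewrite !inE => /eqP-> /eqP->; rewrite adj_irr.
    by move=> x y; rewrite !inE => /orP[] /eqP-> /eqP->; rewrite // adj_sym.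
exists [set u; a], ([set b; d] :|: [set c]); split.
- by apply: cov2 => v; rewrite !inE => /or4P[|||/orP[]] ->; rewrite ?orbT.
- exact: clique2.
- apply: biclique_multipartite; first exact: independent2.
    by move=> x y; rewrite !inE => /eqP-> /eqP->; rewrite adj_irr.
  by move=> x y; rewrite !inE => /orP[] /eqP-> /eqP->; rewrite // adj_sym.
Qed.

Lemma closed_mem (H : sgraph) (D : seq H) (x y z t v w : H) :
  p4_closed D -> p4 x y z t -> w \in D -> w \in [:: x; y; z; t] ->
  v \in [:: x; y; z; t] -> v \in D.
Proof.
move=> cl h wD win vin; apply: (allP (cl _ _ _ _ h _)) => //.
by apply/hasP; exists w.
Qed.

Ltac try_cross cross x y z t :=
  exfalso; apply: (cross x y z t); rewrite ?inE ?eqxx ?orbT // /p4; facts; by [].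

(** The case where N and A are empty. All of R treats u alike, so u either joins one side of a split
    cover ([generic1], [generic0]), lies on a P_4 with r0 against closure, or is a twin of a
    midpoint or an endpoint. *)
Lemma head_polar (H : sgraph) (R : {set H}) (a b c d u r0 : H) :
  minimal_nonpolar H -> p4 a b c d -> p4_closed [:: u; a; b; c; d] ->
  {in R, forall r, r \notin [:: u; a; b; c; d] /\
    [/\ ~~ adj r a, adj r b, adj r c & ~~ adj r d]} ->
  {in R &, forall r s, adj r u = adj s u} -> r0 \in R ->
  (forall v, v \in [:: u; a; b; c; d] \/ v \in R) ->
  polar [set: H].
Proof.
move=> mH h cl RW Ru r0R cov.
have /and5P[ab bc cd ac /andP[ad bd]] := h.
have un := p4_uniq h; have := un; rewrite /= !inE !negb_or andbT.
case/and3P=> /and3P[nab nac nad] /andP[nbc nbd] ncd.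
have [r0D [ra rb rc rd]] := RW r0 r0R.
have [KR [IR [/subsetP covR cKR iIR]]] : is_split R.
  apply: (head_split mH nad ad nab); rewrite 1?eq_sym //.
    by apply/negP => /RW[]; rewrite !inE eqxx !orbT.
  by move=> r /RW[_ [-> _ _ ->]].
have covKI (Y Z : {set H}) : {subset [:: u; a; b; c; d] <= Y :|: Z} ->
    [set: H] \subset (Y :|: (KR :&: R)) :|: (Z :|: (IR :&: R)).
  move=> sub; apply/subsetP=> v _; case: (cov v) => [/sub|vR].
    by rewrite !in_setU => /orP[] ->; rewrite ?orbT.
  have := covR v vR; rewrite !in_setU !in_setI vR !andbT.
  by case/orP=> ->; rewrite !orbT.
have cK (Y : {set H}) : clique Y -> {in R & Y, forall r y, adj r y} ->
    clique (Y :|: (KR :&: R)).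
  move=> cY RY; apply: cliqueU => //; first exact: cliqueS (subsetIl _ _) cKR.
  by move=> y r yY; rewrite in_setI => /andP[_ rR] _; rewrite adj_sym RY.
have iI (Z : {set H}) : independent Z -> {in R & Z, forall r z, ~~ adj r z} ->
    independent (Z :|: (IR :&: R)).
  move=> iZ RZ; apply: independentU => //; first exact: independentS (subsetIl _ _) iIR.
  by move=> z r zZ; rewrite in_setI => /andP[_ rR]; rewrite adj_sym RZ.
have Rbc : {in R & [set b; c], forall r y, adj r y}.
  by move=> r y /RW[_ [_ ? ? _]]; rewrite !inE => /orP[] /eqP->.
have Rad : {in R & [set a; d], forall r y, ~~ adj r y}.
  by move=> r y /RW[_ [? _ _ ?]]; rewrite !inE => /orP[] /eqP->.
have generic1 : adj r0 u -> (u == b) || adj u b -> (u == c) || adj u c ->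
    polar [set: H].
  move=> ru ub uc; apply: split_polar.
  exists ((u |: [set b; c]) :|: (KR :&: R)), ([set a; d] :|: (IR :&: R)); split.
  - by apply: covKI => v; rewrite !inE => /or4P[|||/orP[]] ->; rewrite ?orbT.
  - apply: cK.
      apply: cliqueU; [|exact: clique2|].
        by move=> x y; rewrite !inE => /eqP-> /eqP->; rewrite eqxx.
      by move=> x y; rewrite !inE => /eqP-> /orP[] /eqP-> ne;
        [move: ub|move: uc]; rewrite (negPf ne).
    move=> r y rR; rewrite in_setU in_set1 => /orP[/eqP->|].
      by rewrite (Ru r r0).
    exact: Rbc.
  - by apply: iI => //; apply: independent2.
have generic0 : ~~ adj r0 u -> ~~ adj u a -> ~~ adj u d -> polar [set: H].
  move=> ru ua ud; apply: split_polar.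
  exists ([set b; c] :|: (KR :&: R)), ((u |: [set a; d]) :|: (IR :&: R)); split.
  - by apply: covKI => v; rewrite !inE => /or4P[|||/orP[]] ->; rewrite ?orbT.
  - by apply: cK => //; apply: clique2.
  - apply: iI.
      apply: independentU1; first exact: independent2.
      by move=> y; rewrite !inE => /orP[] /eqP->.
    move=> r y rR; rewrite in_setU in_set1 => /orP[/eqP->|].
      by rewrite (Ru r r0).
    exact: Rad.
have [eu|nua] := eqVneq u a; first by apply: generic0; rewrite eu ?adj_irr.
have [eu|nub] := eqVneq u b.
  by apply: generic1; rewrite eu ?eqxx // bc orbT.
have [eu|nuc] := eqVneq u c.
  by apply: generic1; rewrite eu ?eqxx // adj_sym bc orbT.
have [eu|nud] := eqVneq u d.
  by apply: generic0; rewrite eu ?adj_irr // adj_sym.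
have hrev := p4_rev h.
have covrev v : v \in [:: u; d; c; b; a] \/ v \in R.
  case: (cov v) => [vD|]; [left|by right].
  by move: vD; rewrite !inE => /or4P[|||/orP[]] ->; rewrite ?orbT.
have Rall r : r \in R -> [/\ ~~ adj r a, adj r b, adj r c, ~~ adj r d & adj r u = adj r0 u].
  by move=> rR; have [_ [? ? ? ?]] := RW r rR; split=> //; apply: Ru.
have cross x y z t : p4 x y z t -> u \in [:: x; y; z; t] -> r0 \in [:: x; y; z; t] -> False.
  move=> h' uin rin; case/negP: r0D; apply: closed_mem cl h' _ uin rin.
  by rewrite inE eqxx.
case ru: (adj r0 u); case ua: (adj u a); case ub: (adj u b); case uc: (adj u c);
  case ud: (adj u d).
(* Of the 32 adjacency patterns of u, four survive: twins of b and c, then twins of a and d, each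
   pair exchanged by reversing the path. *)
all: first
  [ by apply: generic1; rewrite ?ub ?uc ?orbT
  | by apply: generic0; rewrite ?ru ?ua ?ud
  | try_cross cross d u b r0 | try_cross cross a b r0 u | try_cross cross a u r0 c
  | try_cross cross r0 b a u | try_cross cross r0 c d u | try_cross cross a u c r0
  | try_cross cross d c r0 u | try_cross cross b r0 u d | idtac ].
- apply: (midpoint_twin_polar mH h (u := u)); rewrite ?ua ?ub ?uc ?ud //.
  by move=> r /Rall[? ? ? ? e]; rewrite e ru.
- apply: (midpoint_twin_polar mH hrev (u := u)); rewrite ?ua ?ub ?uc ?ud //.
  by move=> r /Rall[? ? ? ? e]; rewrite e ru.
- apply: (endpoint_twin_polar mH h (u := u)); rewrite ?ua ?ub ?uc ?ud //.
  by move=> r /Rall[? ? ? ? e]; rewrite e ru.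
- apply: (endpoint_twin_polar mH hrev (u := u)); rewrite ?ua ?ub ?uc ?ud //.
  by move=> r /Rall[? ? ? ? e]; rewrite e ru.
Qed.

(** By closure, N is anticomplete and A complete to R: a violation would give a path n r b a or a x
    c r leaving [D]. If N is nonempty, N, R and [D] together induce a disconnected split graph, and
    A extends its clique. *)
Lemma extendible_polar (H : sgraph) (a b c d : H) :
  P4_extendible H -> minimal_nonpolar H -> connected H -> joinless H ->
  p4 a b c d -> polar [set: H].
Proof.
move=> ext mH cn jl h; have [u cl uP] := extendible_closed ext h.
have /and5P[ab bc cd ac /andP[ad bd]] := h.
pose W := [:: a; b; c; d]; pose D := u :: W.
have WD w : w \in W -> w \in D by move=> wW; rewrite in_cons wW orbT.
have allWD : all (mem D) W by apply/allP.
have [aW bW cW dW] : [/\ a \in W, b \in W, c \in W & d \in W].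
  by rewrite !inE !eqxx ?orbT.
have ty v : v \notin D -> p4_type a b c d v by move=> vD; apply: closed_type cl _ vD h.
(* On its P_4 with three vertices of W, u is an end or an inner vertex, and an outside vertex sees
   both ends alike and both inner vertices alike. Hence u is seen like some w of W, and types extend
   to [D]. *)
have [w wW uw] : exists2 w, w \in W & forall v, v \notin D -> adj v u = adj v w.
  case: uP => [uW|[x [y [z [/and4P[xW yW zW _] hu]]]]]; first by exists u.
  have uD : u \in D by rewrite in_cons eqxx.
  case: hu => hu; [exists z => // v vD|exists y => // v vD].
    have sub : all (mem D) [:: u; x; y; z].
      by apply/and5P; split=> //; apply: WD.
    by have [] := closed_type cl sub vD hu.
  have sub : all (mem D) [:: x; u; y; z].
    by apply/and5P; split=> //; apply: WD.
  by have [] := closed_type cl sub vD hu.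
pose N := [set v | (v \notin D) && ~~ adj v b].
pose A := [set v | (v \notin D) && adj v a].
pose R := [set v | (v \notin D) && (adj v b && ~~ adj v a)].
have NP n : n \in N -> n \notin D /\ {in D, forall x, ~~ adj n x}.
  rewrite in_set => /andP[nD nb]; split=> //; have [ead ebc ab'] := ty n nD.
  have nW : {in W, forall x, ~~ adj n x}.
    by move=> x; rewrite !inE => /or4P[] /eqP->; rewrite -?ead -?ebc //;
      apply: contra nb.
  by move=> x; rewrite in_cons => /predU1P[->|]; rewrite ?uw //; apply: nW.
have AP x : x \in A -> x \notin D /\ {in D, forall y, adj x y}.
  rewrite in_set => /andP[xD xa]; split=> //; have [ead ebc ab'] := ty x xD.
  have xW : {in W, forall y, adj x y}.
    by move=> y; rewrite !inE => /or4P[] /eqP->; rewrite -?ead -?ebc //; apply: ab'.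
  by move=> y; rewrite in_cons => /predU1P[->|]; rewrite ?uw //; apply: xW.
have RP r : r \in R -> r \notin D /\ [/\ ~~ adj r a, adj r b, adj r c & ~~ adj r d].
  by rewrite in_set => /and3P[rD rb ra]; split=> //; have [<- <- _] := ty r rD.
have cover v : v \notin D -> [|| v \in N, v \in A | v \in R].
  by rewrite !in_set => -> /=; case: (adj v a); case: (adj v b).
have cross x y z t v s : p4 x y z t -> s \in W -> s \in [:: x; y; z; t] ->
    v \in [:: x; y; z; t] -> v \notin D -> False.
  by move=> h' sW sin vin /negP; apply; apply: closed_mem cl h' (WD s sW) sin vin.
have NR n r : n \in N -> r \in R -> ~~ adj n r.
  move=> /NP[nD nW] /RP[rD [ra rb rc rd]]; apply/negP => nr.
  have [na nb] := (nW a (WD a aW), nW b (WD b bW)).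
  have h' : p4 n r b a by rewrite /p4; facts.
  by apply: cross h' aW _ _ nD; rewrite !inE eqxx ?orbT.
have AR x r : x \in A -> r \in R -> adj x r.
  move=> /AP[xD xW] /RP[rD [ra rb rc rd]]; apply: contraT => xr; exfalso.
  have [xa xc] := (xW a (WD a aW), xW c (WD c cW)).
  have h' : p4 a x c r by rewrite /p4; facts.
  by apply: cross h' aW _ _ xD; rewrite !inE eqxx ?orbT.
have [N0|/set0Pn[n nN]] := eqVneq N set0.
  (* With N empty, A is complete to everything else, so a nonempty A would make H a join. *)
  have [A0|A0] := eqVneq A set0; last first.
    exfalso; apply: (jl A A0).
      by apply/set0Pn; exists a; rewrite in_setC; apply/negP => /AP[]; rewrite (WD a aW).
    move=> x v xA; rewrite in_setC => vA; have [_ xD] := AP x xA.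
    have [vD|vD] := boolP (v \in D); first exact: xD.
    by have := cover v vD; rewrite N0 in_set0 (negPf vA) /=; apply: AR.
  have cov v : v \in D \/ v \in R.
    have [vD|vD] := boolP (v \in D); [by left|right].
    by have := cover v vD; rewrite N0 A0 !in_set0.
  have [R0|/set0Pn[r rR]] := eqVneq R set0.
    apply: (p4_plus_one_polar h (u := u)) => v.
    by case: (cov v) => //; rewrite R0 in_set0.
  apply: (@head_polar H R a b c d u r) => // s t.
  move=> /RP[sD [sa sb sc sd]] /RP[tD [ta tb tc td]]; rewrite !uw //.
  by move: wW; rewrite !inE => /or4P[] /eqP->; facts.
have iN : independent N.
  apply: (anticomplete_p4_independent mH cn h) => v /NP[vD vW].
  split; first by apply: contra vD; apply: WD.
  by move=> x /WD; apply: vW.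
pose S := N :|: (R :|: [set x in D]).
have SN v : v \in S :\: N -> v \in R \/ v \in D.
  by rewrite in_setD !in_setU in_set => /andP[/negPf-> /=] /orP.
have [K [I [/subsetP cov cK iI]]] : is_split S.
  apply: (connected_p4_split mH cn h nN (subsetUl _ _)).
    move=> x xW; rewrite in_setD !in_setU [x \in [set _ in _]]in_set (WD x xW) !orbT andbT.
    by apply/negP => /NP[]; rewrite (WD x xW).
  by move=> m v mN /SN[vR|vD]; [exact: NR|have [_] := NP m mN; apply].
have cA : clique A.
  apply: (p4_clique mH cn jl h).
  - move=> x /AP[xD xW]; split; first by apply: contra xD; apply: WD.
    by move=> y /WD; apply: xW.
  - move=> v vA; have [vD|vD] := boolP (v \in D).
      by apply: Or31 => x /AP[_ xD]; rewrite adj_sym xD.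
    have := cover v vD; rewrite (negPf vA) /= => /orP[/NP[_ vn]|vR].
      apply: Or32; split; first by apply: contra vD; apply: WD.
      by move=> x /WD; apply: vn.
    by apply: Or31 => x xA; rewrite adj_sym AR.
  - move=> x y v /AP[xD _] _ _ _; apply/negP => h'.
    by apply: cross h' aW _ _ xD; rewrite !inE eqxx ?orbT.
  - move=> x y v /AP[xD _] _ _ _ h'; exfalso.
    by apply: cross h' aW _ _ xD; rewrite !inE eqxx ?orbT.
pose M := R :|: [set x in D].
have MP v : v \in M -> {in A, forall x, adj x v} /\ {in N, forall m, ~~ adj m v}.
  rewrite in_setU in_set => /orP[vR|vD]; first by split=> x xA; [apply: AR|apply: NR].
  by split=> [x /AP[_]|m /NP[_]]; apply.
apply: split_polar; exists (A :|: (K :&: M)), (N :|: (I :&: M)); split.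
- apply/subsetP=> v _; have [vM|vM] := boolP (v \in M).
    have vS' : v \in S by rewrite in_setU vM orbT.
    have := cov v vS'; rewrite !in_setU !in_setI vM !andbT => /orP[] ->;
      by rewrite ?orbT.
  have vD : v \notin D by apply: contra vM => vD; rewrite in_setU in_set vD orbT.
  have /or3P[vN|vA|vR] := cover v vD.
  + by rewrite !in_setU vN !orbT.
  + by rewrite !in_setU vA.
  + by rewrite in_setU vR in vM.
- apply: cliqueU => //; first exact: cliqueS (subsetIl _ _) cK.
  by move=> x v xA; rewrite in_setI => /andP[_ /MP[vA _]] _; apply: vA.
- apply: independentU => //; first exact: independentS (subsetIl _ _) iI.
  by move=> m v mN; rewrite in_setI => /andP[_ /MP[_ vn]]; apply: vn.
Qed.

(** * Conclusion *)

Lemma minimal_joinless (H : sgraph) : minimal_nonpolar H -> joinless H.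
Proof.
move=> [nH mH] X X0 Y0 XY; apply: nH; apply: (join_polar XY); apply: mH;
  rewrite properT; apply/eqP => e.
  by rewrite e setCT eqxx in Y0.
by rewrite -(setCK X) e setCT eqxx in X0.
Qed.

Lemma connected_minimal_p4 (H : sgraph) :
  minimal_nonpolar H -> connected H -> exists a b c d : H, p4 a b c d.
Proof.
move=> mH cn.
have [/existsP[a /existsP[b /existsP[c /existsP[d h]]]]|no] :=
  boolP [exists a : H, exists b : H, exists c : H, exists d : H, p4 a b c d].
  by exists a, b, c, d.
have no4 (a b c d : H) : ~~ p4 a b c d.
  apply: contra no => h; apply/existsP; exists a; apply/existsP; exists b.
  by apply/existsP; exists c; apply/existsP; exists d.
have [lt1|le1] := ltnP 1 #|[set: H]|; last first.
  case: mH => nH _; case: nH; apply: split_polar; exists set0, setT.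
  split; [exact: subsetUr|by move=> x y; rewrite inE|].
  by move=> x y _ _; rewrite (card_le1_eqP le1 x y (in_setT x) (in_setT y)) adj_irr.
have [[] [X [_ X0 Y0 XY]]] := p4_free_cut no4 lt1; rewrite setTD in Y0 XY; exfalso.
  exact: minimal_joinless mH X X0 Y0 XY.
apply: (cn X); split=> // x y xy.
have [xX|xX] := boolP (x \in X); have [yX|yX] := boolP (y \in X) => //.
  by have := XY x y xX; rewrite inE yX xy => /(_ isT).
by have := XY y x yX; rewrite inE xX adj_sym xy => /(_ isT).
Qed.

Lemma minimal_nonpolar_pattern (H : sgraph) :
  P4_extendible H \/ P4_sparse H -> minimal_nonpolar H ->
  exists2 E, E \in obstruction_patterns & iso H (pat E).
Proof.
move=> hP mH; have [nH _] := mH.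
(* Tuples of the length of the table form a finite type, which makes the presence of a pattern
   decidable. *)
have [/hasP[E EL /existsP[t ft]]|none] :=
  boolP (has (fun E => [exists t : (size E).-tuple H, fits E t]) obstruction_patterns).
  exists E => //; have [f fi fm] := fits_embed ft.
  by apply: (minimal_embed fi fm) => //; case: (obstructsP (allP obstructions E EL)).
have fr : obstruction_free H.
  move=> E vs EL; apply: contra none => ft; apply/hasP; exists E => //.
  have sz : size vs == size E by move: ft; rewrite /fits; case: vs => // x s /and3P[].
  by apply/existsP; exists (Tuple sz).
have cn : connected H by move=> X sX; apply: nH; apply: separable_polar fr sX.
have jl := minimal_joinless mH.
have [a [b [c [d h]]]] := connected_minimal_p4 mH cn.
exfalso; apply: nH; case: hP => hP; first exact: extendible_polar hP mH cn jl h.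
exact/split_polar/(sparse_split hP mH cn jl h).
Qed.

Theorem theorem54 (C : sgraph -> Prop) (hiso : graph_class C)
    (hP4 : (forall H : sgraph, C H -> P4_extendible H) \/
           (forall H : sgraph, C H -> P4_sparse H))
    (hcompl : compl_closed C) (hind : induced_closed C)
    (G : sgraph) (hG : C G) :
  minimal_monopolar_obstruction G <->
  iso (compl G) (union (complete 1) (copies 2 (complete 2))) \/
  iso (compl G) (copies 2 (path_graph 3)) \/
  iso (compl G) (union (copies 2 (complete 1)) (cycle_graph 4)) \/
  iso (compl G)
    (union (complete 1) (compl (union (path_graph 3) (complete 2)))) \/
  iso (compl G) (union (complete 1) (cycle_graph 5)) \/
  iso (compl G) (union (complete 1) banner) \/
  iso (compl G) (union (complete 1) (compl (path_graph 5))).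
Proof.
(* Closure under complements carries the hypothesis on P_4s to the graph where the argument takes
   place. *)
have hP : P4_extendible (compl G) \/ P4_sparse (compl G).
  by case: hP4 => hP; [left|right]; apply/hP/hcompl.
split=> [/minimal_monopolarE/(minimal_nonpolar_pattern hP)[E EL i]|].
  move: EL; rewrite !inE => /or4P[|||/or4P[]] /eqP e; rewrite {}e in i.
  - by left; apply: iso_trans i iso_K1_2K2.
  - by right; left; apply: iso_trans i iso_2P3.
  - by do 4 right; left; apply: iso_trans i iso_K1_C5.
  - by do 2 right; left; apply: iso_trans i iso_2K1_C4.
  - by do 3 right; left; apply: iso_trans i iso_K1_coP3K2.
  - by do 5 right; left; apply: iso_trans i iso_K1_banner.
  - by do 6 right; apply: iso_trans i iso_K1_house.
have obs E F : E \in obstruction_patterns -> iso (pat E) F -> iso (compl G) F ->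
    minimal_monopolar_obstruction G.
  move=> EL EF GF; apply/minimal_monopolarE.
  apply: iso_minimal_nonpolar (iso_trans GF (iso_sym EF)) _.
  exact: obstructsP (allP obstructions E EL).
case=> [|[|[|[|[|[|]]]]]].
- exact: obs iso_K1_2K2.
- exact: obs iso_2P3.
- exact: obs iso_2K1_C4.
- exact: obs iso_K1_coP3K2.
- exact: obs iso_K1_C5.
- exact: obs iso_K1_banner.
- exact: obs iso_K1_house.
Qed.
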